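(* Let $a:M^n \rightarrow H^{n+1}_1(-1)$ be a spacelike immersion and let $G: M^n \to {Q^*}^n$ be the Gauss map of this immersion. Denote by $\lambda_1,\ldots,\lambda_n$ the eigenvalues of the shape operator of $a$ associated to the unit normal $b$ that was used to construct $G$. If $H$ is the mean curvature vector of $G$, then $$g(JH,\cdot)=\frac{1}{n}\, d\left(\sum_{j=1}^n\arctan(\lambda_j)\right)=\frac{1}{n}\, d\left(\mathrm{Im}\left(\log\left(\prod_{j=1}^n (1+i\lambda_j)\right)\right)\right)$$ as one-forms on $M^n$.
   Context: $\mathbb R^d_i$ is $\mathbb R^d$ with the metric $\langle x,y\rangle_i=-x_1y_1-\cdots-x_iy_i+x_{i+1}y_{i+1}+\cdots+x_dy_d$. Anti-de Sitter space is $H^{n+1}_1(-1)=\{x\in\mathbb R^{n+2}_2 : \langle x,x\rangle_2=-1\}$. $\mathbb C^{n+2}_2$ is $\mathbb C^{n+2}$ with the metric $\langle\!\langle z,w\rangle\!\rangle_2=\mathrm{Re}(-z_0\bar w_0-z_1\bar w_1+z_2\bar w_2+\cdots+z_{n+1}\bar w_{n+1})$, and $H^{2n+3}_3(-1)=\{z\in\mathbb C^{n+2}_2 : \langle\!\langle z,z\rangle\!\rangle_2=-1\}$. Complex anti-de Sitter space $\mathbb CH^{n+1}_1(-4)$ is the set of complex lines in $\mathbb C^{n+2}_2$ on which $\langle\!\langle\cdot,\cdot\rangle\!\rangle_2$ is negative definite, with the pseudo-Riemannian metric $g$ making the Hopf fibration $\pi:H^{2n+3}_3(-1)\to\mathbb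 CH^{n+1}_1(-4)$, $z\mapsto[z]$, a pseudo-Riemannian submersion, and with the complex structure $J$ induced by multiplication by $i$. The complex hyperbolic quadric is ${Q^*}^n=\{[(z_0,\ldots,z_{n+1})]\in\mathbb CH^{n+1}_1(-4) : -z_0^2-z_1^2+z_2^2+\cdots+z_{n+1}^2=0\}$ with the induced metric and complex structure, again denoted $g$ and $J$; it is a Riemannian Kähler manifold of complex dimension $n$. For a spacelike immersion $a:M^n\to H^{n+1}_1(-1)\subset\mathbb R^{n+2}_2$ with unit normal vector field $b$ tangent to $H^{n+1}_1(-1)$ (so $\langle b,b\rangle_2=-1$), the Gauss map is $G:M^n\to{Q^*}^n$, $p\mapsto[a(p)+ib(p)]$. It is a Lagrangian immersion (i.e. $J$ interchanges tangent and normal spaces of $M^n$). The shape operator $S$ associated to $b$ has the sign convention $db(X)=-da(SX)$. The mean curvature vector is normalized as $H=\frac1n\,\mathrm{trace}\,h$, where $h$ is the second fundamental form of $G$ and the trace is taken with respect to the metric on $M^n$ induced by $G$. Tangent vectors to $M^n$ are identified with their images under $dG$, so $g(JH,X)$ means $g(JH,dG(X))$. *)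

(* Defs.v *)
From HB Require Import structures.
From mathcomp Require Import all_boot all_order all_algebra.
From mathcomp Require Import complex.
From mathcomp Require Import all_classical all_reals all_analysis.

Set Implicit Arguments.
Unset Strict Implicit.
Unset Printing Implicit Defensive.

Import Order.TTheory GRing.Theory Num.Theory.
Import numFieldNormedType.Exports.

Local Open Scope classical_set_scope.
Local Open Scope ring_scope.
Local Open Scope complex_scope.

Section Smooth.
Context {R : realType} {V W : normedModType R}.

(* U is meant to be open *)
Fixpoint Ck (k : nat) (U : set V) (f : V -> W) : Prop :=
  match k with
  | 0 => forall x, U x -> {for x, continuous f}
  | k'.+1 => (forall x, U x -> differentiable f x) /\
             (forall v : V, Ck k' U (fun x => 'D_v f x))
  end.

Definition smooth (U : set V) (f : V -> W) : Prop := forall k, Ck k U f.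

End Smooth.

Section Manifold.
Context {R : realType} {n : nat}.

Record chart (M : Type) := Chart {
  dom : set M;
  coord : M -> 'rV[R]_n;
  param : 'rV[R]_n -> M }.

Definition cod (M : Type) (c : chart M) : set 'rV[R]_n := coord c @` dom c.

Definition is_chart (M : topologicalType) (c : chart M) : Prop :=
  [/\ open (dom c), open (cod c),
      forall p, dom c p -> param c (coord c p) = p,
      forall p, dom c p -> {for p, continuous (coord c)} &
      forall x, cod c x -> {for x, continuous (param c)}].

Definition compatible (M : Type) (c1 c2 : chart M) : Prop :=
  smooth [set x | cod c1 x /\ dom c2 (param c1 x)] (coord c2 \o param c1).

End Manifold.
Arguments chart : clear implicits.

Record manifold (R : realType) (n : nat) := Manifold {
  carrier :> topologicalType;
  atlas : set (chart R n carrier);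
  manifold_hausdorff : hausdorff_space carrier;
  manifold_second_countable : @second_countable carrier;
  atlas_chart : forall c, atlas c -> is_chart c;
  atlas_cover : forall p, exists2 c, atlas c & dom c p;
  atlas_compatible : forall c1 c2, atlas c1 -> atlas c2 -> compatible c1 c2 }.

(* A tangent vector at p is given by its components v : 'rV_n in a chart c. *)
Section MapsOnManifold.
Context {R : realType} {n : nat} {M : manifold R n} {W : normedModType R}.

Definition smooth_map (f : M -> W) : Prop :=
  forall c, atlas c -> smooth (cod c) (f \o param c).

Definition differentiable_at (f : M -> W) (c : chart R n M) (p : M) : Prop :=
  differentiable (f \o param c) (coord c p).

Definition differential (f : M -> W) (c : chart R n M) (p : M)
  (v : 'rV[R]_n) : W := 'd (f \o param c) (coord c p) v.

End MapsOnManifold.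

(* Local coordinate formulas of Riemannian geometry: g is the metric matrix in a
   coordinate domain of R^m, f the coordinate expression of an immersion. *)
Section RiemannianCoordinates.
Context {R : realType} {n m : nat}.

Definition partial {k : nat} {W : normedModType R} (i : 'I_k)
  (f : 'rV[R]_k -> W) (x : 'rV[R]_k) : W := 'D_(delta_mx 0 i) f x.

(* Gamma^c_{ab} of the Levi-Civita connection of g *)
Definition christoffel (g : 'rV[R]_m -> 'M[R]_m) (y : 'rV[R]_m)
  (a b c : 'I_m) : R :=
  2^-1 * \sum_(d < m) invmx (g y) c d *
    (partial a (fun y => g y b d) y + partial b (fun y => g y a d) y
     - partial d (fun y => g y a b) y).

Variables (g : 'rV[R]_m -> 'M[R]_m) (f : 'rV[R]_n -> 'rV[R]_m).

(* covariant derivative of the vector field df(e_j) along f in the direction e_i *)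
Definition covariant_derivative (x : 'rV[R]_n) (i j : 'I_n) : 'rV[R]_m :=
  \row_c (partial i (fun x => partial j f x 0 c) x +
          \sum_(a < m) \sum_(b < m) christoffel g (f x) a b c *
             partial i f x 0 a * partial j f x 0 b).

(* the i-th row of the Jacobian is df(e_i) *)
Definition induced_metric (x : 'rV[R]_n) : 'M[R]_n :=
  jacobian f x *m g (f x) *m (jacobian f x)^T.

Definition tangential_part (x : 'rV[R]_n) (w : 'rV[R]_m) : 'rV[R]_m :=
  w *m g (f x) *m (jacobian f x)^T *m invmx (induced_metric x) *m jacobian f x.

Definition second_fundamental_form (x : 'rV[R]_n) (i j : 'I_n) : 'rV[R]_m :=
  covariant_derivative x i j - tangential_part x (covariant_derivative x i j).

Definition mean_curvature (x : 'rV[R]_n) : 'rV[R]_m :=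
  n%:R^-1 *: \sum_(i < n) \sum_(j < n)
    invmx (induced_metric x) i j *: second_fundamental_form x i j.

End RiemannianCoordinates.

Section PseudoEuclidean.
Context {R : realType} {d : nat}.

Definition signature (i : nat) (j : 'I_d) : R := if (j < i)%N then -1 else 1.

Definition pscal (i : nat) (x y : 'rV[R]_d) : R :=
  \sum_(j < d) signature i j * x 0 j * y 0 j.

Definition pscalC (i : nat) (z w : 'rV[R[i]]_d) : R :=
  complex.Re (\sum_(j < d) (signature i j)%:C * z 0 j * conjc (w 0 j)).

Definition cbilin (i : nat) (z w : 'rV[R[i]]_d) : R[i] :=
  \sum_(j < d) (signature i j)%:C * z 0 j * w 0 j.

Definition imul (z : 'rV[R[i]]_d) : 'rV[R[i]]_d := (0 +i* 1 : R[i]) *: z.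

(* x + i y *)
Definition cplx (x y : 'rV[R]_d) : 'rV[R[i]]_d := \row_j (x 0 j +i* y 0 j).

(* the identification of C^d with R^(d + d) through which C^d carries its
   topology and smooth structure *)
Definition toC (u : 'rV[R]_(d + d)) : 'rV[R[i]]_d := cplx (lsubmx u) (rsubmx u).
Definition ofC (z : 'rV[R[i]]_d) : 'rV[R]_(d + d) :=
  row_mx (map_mx (@complex.Re R) z) (map_mx (@complex.Im R) z).

Definition line (z : 'rV[R[i]]_d) : set 'rV[R[i]]_d :=
  [set w | exists c : R[i], w = c *: z].

End PseudoEuclidean.

Section HyperbolicQuadric.
Context {R : realType} {n : nat}.

Definition anti_de_sitter : set 'rV[R]_n.+2 := [set x | pscal 2 x x = -1].

(* total space of the Hopf fibration z |-> line z *)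
Definition hopf_total : set 'rV[R[i]]_n.+2 := [set z | pscalC 2 z z = -1].

Definition complex_anti_de_sitter : set (set 'rV[R[i]]_n.+2) :=
  [set L | exists z, [/\ z != 0, L = line z &
     forall w, L w -> w != 0 -> pscalC 2 w w < 0]].

Definition quadric : set (set 'rV[R[i]]_n.+2) :=
  [set L | complex_anti_de_sitter L /\
     exists2 z, L = line z & cbilin 2 z z = 0].

(* For z in hopf_total and w in C^{n+2}: the component of w orthogonal to z and
   i z, i.e. the horizontal part at z of the component tangent to hopf_total. *)
Definition horizontal (z w : 'rV[R[i]]_n.+2) : 'rV[R[i]]_n.+2 :=
  w + (pscalC 2 w z)%:C *: z + (pscalC 2 w (imul z))%:C *: imul z.

(* A local parametrization y |-> line (qlift y) of the quadric by an open subset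
   of R^{2n}, given through a smooth lift to hopf_total, with inverse qcoord. *)
Record qchart := QChart {
  qcod : set 'rV[R]_(n + n);
  qlift : 'rV[R]_(n + n) -> 'rV[R[i]]_n.+2;
  qcoord : set 'rV[R[i]]_n.+2 -> 'rV[R]_(n + n) }.

Definition qdom (k : qchart) : set (set 'rV[R[i]]_n.+2) :=
  [set line (qlift k y) | y in qcod k].

(* A function on an open subset of the quadric is smooth when, viewed on the
   cone over it, it extends smoothly to an open subset of C^{n+2}. *)
Definition quadric_chart (k : qchart) : Prop :=
  [/\ open (qcod k),
      smooth (qcod k) (ofC \o qlift k),
      forall y, qcod k y -> hopf_total (qlift k y) /\ quadric (line (qlift k y)),
      forall y, qcod k y -> qcoord k (line (qlift k y)) = y &
      exists O : set 'rV[R]_(n.+2 + n.+2),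
        [/\ open O,
            smooth O (qcoord k \o line \o toC) &
            forall u, quadric (line (toC u)) ->
              O u <-> qdom k (line (toC u))]].

(* horizontal lift at qlift y of the tangent vector of the quadric with
   components w in the chart k *)
Definition horizontal_lift (k : qchart) (y w : 'rV[R]_(n + n)) :
  'rV[R[i]]_n.+2 :=
  horizontal (qlift k y) (toC ('d (ofC \o qlift k) y w)).

(* The Hopf fibration is a pseudo-Riemannian submersion: g is evaluated on
   horizontal lifts. *)
Definition qmetric (k : qchart) (y u v : 'rV[R]_(n + n)) : R :=
  pscalC 2 (horizontal_lift k y u) (horizontal_lift k y v).

Definition qmetric_mx (k : qchart) (y : 'rV[R]_(n + n)) : 'M[R]_(n + n) :=
  \matrix_(i, j) qmetric k y (delta_mx 0 i) (delta_mx 0 j).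

(* g (J u, v): J multiplies horizontal lifts by i *)
Definition qmetric_J (k : qchart) (y u v : 'rV[R]_(n + n)) : R :=
  pscalC 2 (imul (horizontal_lift k y u)) (horizontal_lift k y v).

End HyperbolicQuadric.
Arguments qchart : clear implicits.

Section GaussMap.
Context {R : realType} {n : nat} {M : manifold R n}.
Implicit Types (a b : M -> 'rV[R]_n.+2) (c : chart R n M) (p : M).

Definition spacelike_immersion a : Prop :=
  [/\ smooth_map a,
      forall p, anti_de_sitter (a p),
      forall c p v, atlas c -> dom c p -> differential a c p v = 0 -> v = 0 &
      forall c p v, atlas c -> dom c p -> v != 0 ->
        0 < pscal 2 (differential a c p v) (differential a c p v)].

Definition unit_normal a b : Prop :=
  [/\ smooth_map b,
      forall p, pscal 2 (b p) (b p) = -1,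
      forall p, pscal 2 (b p) (a p) = 0 &
      forall c p v, atlas c -> dom c p ->
        pscal 2 (b p) (differential a c p v) = 0].

Definition gauss_map a b p : set 'rV[R[i]]_n.+2 := line (cplx (a p) (b p)).

(* The matrix S, acting on row vectors of components in the chart c, such that
   db(v) = - da(S v); it is unique since a is an immersion. *)
Definition shape_operator a b c p : 'M[R]_n :=
  xget 0 [set S : 'M[R]_n | forall v,
    differential b c p v = - differential a c p (v *m S)].

Definition shape_eigenvalues a b (lam : M -> 'I_n -> R) : Prop :=
  forall c p, atlas c -> dom c p ->
    char_poly (shape_operator a b c p) = \prod_(j < n) ('X - (lam p j)%:P).

Definition gauss_map_coord a b c (k : qchart R n) : 'rV[R]_n -> 'rV[R]_(n + n) :=
  qcoord k \o gauss_map a b \o param c.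

(* mean curvature vector of the Gauss map, in components *)
Definition gauss_mean_curvature a b c (k : qchart R n) p : 'rV[R]_(n + n) :=
  mean_curvature (qmetric_mx k) (gauss_map_coord a b c k) (coord c p).

(* the one-form g(JH, . ) on M *)
Definition gJH a b c (k : qchart R n) p (v : 'rV[R]_n) : R :=
  let x := coord c p in let G := gauss_map_coord a b c k in
  qmetric_J k (G x) (gauss_mean_curvature a b c k p) ('d G x v).

End GaussMap.

Section Logarithm.
Context {R : realType}.

Definition cexp (z : R[i]) : R[i] :=
  (expR (complex.Re z))%:C * (cos (complex.Im z) +i* sin (complex.Im z)).

Definition log_branch (T : topologicalType) (U : set T) (F L : T -> R[i]) : Prop :=
  [/\ open U,
      forall q, U q -> cexp (L q) = F q,
      forall q, U q -> {for q, continuous (fun q => complex.Re (L q))} &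
      forall q, U q -> {for q, continuous (fun q => complex.Im (L q))}].

End Logarithm.

(* Main.v *)
Require Import Defs.
From HB Require Import structures.
From mathcomp Require Import all_boot all_order all_algebra.
From mathcomp Require Import perm complex ring lra.
From mathcomp Require Import all_classical all_reals all_analysis.

Set Implicit Arguments.
Unset Strict Implicit.
Unset Printing Implicit Defensive.

Import Order.TTheory GRing.Theory Num.Theory.
Import numFieldNormedType.Exports.

Local Open Scope classical_set_scope.
Local Open Scope ring_scope.
Local Open Scope complex_scope.

(** Why the theorem is true.

In a chart of M the Gauss map has the lift zeta = a + i b to the cone over
the quadric. It differs from the unit lift z = Q o f given by a chart of the
quadric only by a complex factor of constant modulus, zeta = (c1 + i c2) z, so
that da(v) + i db(v) is, up to this factor, the horizontal lift of dG(v)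
[phase_hopf_lift_gauss]. The Levi-Civita connection of the quadric is read
upstairs as well: differentiating horizontal lifts, with a correction for the
rotation of the lift along the Hopf fibre, is symmetric and metric, hence is
the Levi-Civita connection by Koszul's argument [christoffel_hopf_metric,
hopf_lift_covariant_derivative]. As J maps tangent vectors of the Gauss image
to horizontal vectors that are still tangent to the quadric, the phase drops
out and, with <,> the metric of R^(n+2)_2,

  g(J nabla_i dG(e_j), dG(v)) = (<a_ij, b_v> - <b_ij, a_v>) / 2
                                            [gauss_covariant_derivative].

The tangential part of nabla_i dG(e_j) does not contribute because G is
Lagrangian [gauss_lagrangian].

The right-hand side is totally symmetric, so v may be traded for a direction
of differentiation [codazzi]. Write A for the first fundamental form, h = S A
for the second one and S for the shape operator. The metric induced by G is
(A + S A S^T) / 2, and the trace of the display above becomes the imaginary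
part of trace((A + i h)^-1 d(A + i h)) [trace_identity,
gauss_mean_curvature_form]. By Jacobi's formula [cderive_det] this is the
derivative of any continuous argument of det(A + i h)
[cderive_argument], and det(A + i h) = det A det(1 + i S) is det A, which is
real and does not vanish, times the product of the 1 + i lambda_j
[det_one_plus_i_shape].

Both the sum of the arctan lambda_j and the imaginary part of a branch of the
logarithm are such arguments. For the former, continuity is the point: the
lambda_j are only given pointwise and in no particular order, but symmetric
sums over the roots of a real-rooted polynomial depend continuously on its
coefficients [cvg_symmetric_sum]. *)

(** * Derivatives of matrix-valued maps *)

Section Calculus.
Context {R : realType} {V : normedModType R}.

(** The difference of the two maps vanishes near x, so it is o(h) with zero
    differential. *)
Lemma near_eq_differentiable (W : normedModType R) (f g : V -> W) (x : V) :
  {near x, f =1 g} -> differentiable f x -> differentiable g x.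
Proof.
move=> fg df; rewrite -(subrK f g); apply: differentiableD => //.
set k := g - f.
have k0 : {near x, k =1 cst 0}.
  near=> y; rewrite /k (_ : (g - f) y = g y - f y)//.
  by rewrite (near fg y)// subrr.
have kO : k \o shift x = cst (k x) + (\0 : {linear V -> W}) +o_ 0 id.
  apply/eqaddoP => _/posnumP[e]; near=> h.
  have kx : k x = 0 := nbhs_singleton k0.
  rewrite !fctE /= kx (_ : k (h + x) = 0) ?addr0 ?subr0 ?normr0 ?mulr_ge0//.
  near: h; have := k0; rewrite (near_shift 0) /=.
  by apply: filterS => h /=; rewrite subr0.
have c0 : continuous (\0 : {linear V -> W}) by move=> y; exact: cvg_cst.
apply/diff_locallyP; rewrite (diff_unique c0 kO); split => //.
Unshelve. all: by end_near. Qed.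

(** Such a map is a finite combination of coordinate functions; this is what
    makes it continuous, whatever the norm of the target. *)
Lemma linear_differentiable_mx m n (W : normedModType R)
    (L : {linear 'M[R]_(m, n) -> W}) (M : 'M[R]_(m, n)) : differentiable L M.
Proof.
have -> : (L : _ -> _) = \sum_i \sum_j (fun N : 'M[R]_(m, n) =>
    N i j *: L (delta_mx i j)).
  apply/funext => N; rewrite {1}(matrix_sum_delta N) linear_sum fct_sumE.
  apply: eq_bigr => i _; rewrite linear_sum fct_sumE.
  by apply: eq_bigr => j _; rewrite linearZ.
apply: differentiable_sum => i; apply: differentiable_sum => j.
exact/differentiableZl/differentiable_coord.
Qed.

Lemma differentiable_linear_comp m n (W : normedModType R)
    (L : {linear 'M[R]_(m, n) -> W}) (F : V -> 'M[R]_(m, n)) (x : V) :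
  differentiable F x -> differentiable (fun y => L (F y)) x.
Proof.
by move=> dF; exact: (differentiable_comp dF (linear_differentiable_mx L _)).
Qed.

Lemma derive_linear_comp m n (W : normedModType R)
    (L : {linear 'M[R]_(m, n) -> W}) (F : V -> 'M[R]_(m, n)) (x v : V) :
  differentiable F x -> 'D_v (fun y => L (F y)) x = L ('D_v F x).
Proof.
move=> dF; have dL := linear_differentiable_mx L (F x).
rewrite deriveE; last exact: (differentiable_comp dF dL).
rewrite (_ : (fun y => L (F y)) = L \o F)// diff_comp// deriveE//= diff_lin//.
by move=> M; apply/differentiable_continuous/linear_differentiable_mx.
Qed.

Lemma differentiable_entry m n (F : V -> 'M[R]_(m, n)) (x : V) i j :
  differentiable F x -> differentiable (fun y => F y i j) x.
Proof.
by move=> dF; exact: (differentiable_comp dF (differentiable_coord _ i j)).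
Qed.

Lemma derive_entry m n (F : V -> 'M[R]_(m, n)) (x v : V) i j :
  differentiable F x -> 'D_v (fun y => F y i j) x = 'D_v F x i j.
Proof. by move=> dF; rewrite derive_mx ?mxE//; exact: diff_derivable. Qed.

Lemma differentiable_mx m n (F : V -> 'M[R]_(m, n)) (x : V) :
  (forall i j, differentiable (fun y => F y i j) x) -> differentiable F x.
Proof.
move=> dF.
have -> : F = \sum_i \sum_j (fun y => F y i j *: delta_mx i j).
  apply/funext => y; rewrite {1}(matrix_sum_delta (F y)) fct_sumE.
  by apply: eq_bigr => i _; rewrite fct_sumE.
apply: differentiable_sum => i; apply: differentiable_sum => j.
exact: differentiableZl.
Qed.

Lemma differentiable_scale m n (k : V -> R) (F : V -> 'M[R]_(m, n)) (x : V) :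
  differentiable k x -> differentiable F x ->
  differentiable (fun y => k y *: F y) x.
Proof.
move=> dk dF; apply: differentiable_mx => i j.
rewrite (_ : (fun _ => _) = k * (fun y => F y i j)).
  by apply: differentiableM => //; exact: differentiable_entry.
by apply/funext => y; rewrite mxE.
Qed.

Lemma derive_scale m n (k : V -> R) (F : V -> 'M[R]_(m, n)) (x v : V) :
  differentiable k x -> differentiable F x ->
  'D_v (fun y => k y *: F y) x = 'D_v k x *: F x + k x *: 'D_v F x.
Proof.
move=> dk dF; apply/matrixP => i j; rewrite !mxE -!derive_entry//; last first.
  exact: differentiable_scale.
rewrite (_ : (fun _ => _) = k * (fun y => F y i j)); last first.
  by apply/funext => y; rewrite mxE.
rewrite deriveM; [|exact: diff_derivable|]; last first.
  by apply: diff_derivable; exact: differentiable_entry.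
by rewrite addrC; congr (_ + _); exact: mulrC.
Qed.

Lemma derive_sum_diff (W : normedModType R) n (F : 'I_n -> V -> W) (x v : V) :
  (forall i, differentiable (F i) x) ->
  'D_v (fun y => \sum_i F i y) x = \sum_i 'D_v (F i) x.
Proof.
move=> dF; rewrite -derive_sum; last by move=> i; exact: diff_derivable.
by congr ('D_v _ x); apply/funext => y; rewrite fct_sumE.
Qed.

Lemma differentiable_sumf (W : normedModType R) n (F : 'I_n -> V -> W) (x : V) :
  (forall i, differentiable (F i) x) ->
  differentiable (fun y => \sum_i F i y) x.
Proof.
move=> dF; rewrite (_ : (fun _ => _) = \sum_i F i).
  exact: differentiable_sum.
by apply/funext => y; rewrite fct_sumE.
Qed.

Lemma differentiable_pscal d s (F G : V -> 'rV[R]_d) (x : V) :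
  differentiable F x -> differentiable G x ->
  differentiable (fun y => pscal s (F y) (G y)) x.
Proof.
move=> dF dG; apply: differentiable_sumf => j.
rewrite (_ : (fun _ => _) = signature s j \*:
    ((fun y => F y 0 j) * (fun y => G y 0 j))).
  apply: differentiableZ.
  by apply: differentiableM; exact: differentiable_entry.
by apply/funext => y; rewrite -mulrA.
Qed.

Lemma derive_pscal d s (F G : V -> 'rV[R]_d) (x v : V) :
  differentiable F x -> differentiable G x ->
  'D_v (fun y => pscal s (F y) (G y)) x =
  pscal s ('D_v F x) (G x) + pscal s (F x) ('D_v G x).
Proof.
move=> dF dG; have dFG j : differentiable (signature s j \*:
    ((fun y => F y 0 j) * (fun y => G y 0 j))) x.
  apply: differentiableZ.
  by apply: differentiableM; exact: differentiable_entry.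
rewrite (_ : (fun _ => _) = (fun y => \sum_j (signature s j \*:
    ((fun y => F y 0 j) * (fun y => G y 0 j))) y)); last first.
  apply/funext => y; apply: eq_bigr => j _.
  by rewrite -mulrA.
rewrite derive_sum_diff// -big_split; apply: eq_bigr => j _ /=.
have eF := diff_derivable (v := v) (differentiable_entry 0 j dF).
have eG := diff_derivable (v := v) (differentiable_entry 0 j dG).
rewrite deriveZ; last exact: derivableM.
rewrite deriveM// !derive_entry//.
rewrite /GRing.scale /=; ring.
Qed.

End Calculus.

(** * Symmetry of second derivatives *)

Section SecondOrder.
Context {R : realType}.

(** Differentiability of the first derivatives at the single point x is what
    the symmetry of second derivatives and the second-order chain rule use. *)
Definition twice_differentiable {V W : normedModType R} (f : V -> W) (x : V) :=
  {near x, forall y, differentiable f y} /\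
  forall v, differentiable (fun y => 'D_v f y) x.

Lemma smooth_twice_differentiable {V W : normedModType R} (U : set V)
    (f : V -> W) (x : V) :
  open U -> smooth U f -> U x -> twice_differentiable f x.
Proof.
move=> oU sf Ux; have [df ddf] := sf 2%N; split.
  by apply: filterS (open_nbhs_nbhs (conj oU Ux)) => y Uy; exact: df.
by move=> v; have [+ _] := ddf v; apply.
Qed.

Lemma twice_differentiable1 {V W : normedModType R} (f : V -> W) (x : V) :
  twice_differentiable f x -> differentiable f x.
Proof. by case=> /nbhs_singleton. Qed.

Lemma is_derive_along {V W : normedModType R} (f : V -> W) (w u : V) (s : R) :
  differentiable f (s *: u + w) ->
  is_derive s 1 (fun s : R => f (s *: u + w)) ('D_u f (s *: u + w)).
Proof.
move=> df; have d1 := diff_derivable (v := u) df.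
have E : (fun h : R => h^-1 *: (((fun s : R => f (s *: u + w)) \o shift s)
      (h *: 1) - f (s *: u + w))) =
    (fun h : R => h^-1 *: ((f \o shift (s *: u + w)) (h *: u) -
      f (s *: u + w))).
  by apply/funext => h /=; rewrite [h *: 1]mulr1 scalerDl addrA.
by split; rewrite /derivable /derive E.
Qed.

Let second_difference {V : normedModType R} (f : V -> R) (x u v : V) (t : R) :=
  f (t *: u + (t *: v + x)) - f (t *: u + x) - f (t *: v + x) + f x.

(** Mean value theorem along u, then first-order expansion of 'D_u f at x.
    Since the second difference is symmetric in u and v, this ties the two
    iterated derivatives to the same quantity. *)
Lemma second_difference_approx {V : normedModType R} (f : V -> R) (x u v : V)
    (e : R) : 0 < e -> twice_differentiable f x ->
  \forall t \near 0^'+,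
    `|second_difference f x u v t - t ^+ 2 * 'D_v ('D_u f) x| <= e * t ^+ 2.
Proof.
move=> e0 [df /(_ u) ddf].
pose M := 2 * (`|u| + `|v|) + 1; have M0 : 0 < M.
  by rewrite ltr_pwDr// mulr_ge0// addr_ge0.
have eM0 : 0 < e / M by rewrite divr_gt0.
have /(_ _ eM0) : forall e, 0 < e -> \forall h \near (0 : V),
    `|'D_u f (h + x) - ('D_u f x + 'd ('D_u f) x h)| <= e * `|h|.
  move=> r r0; have := diff_locally ddf => /eqaddoP/(_ _ r0).
  by apply: filterS.
rewrite (near_shift 0 x) /= in df.
have {}df : \forall h \near (0 : V), differentiable f (h + x).
  by move: df; apply: filterS => h /=; rewrite subr0.
move=> H; have {H df} : \forall h \near (0 : V), differentiable f (h + x) /\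
    `|'D_u f (h + x) - ('D_u f x + 'd ('D_u f) x h)| <= e / M * `|h|.
  by near=> h; split; near: h.
move=> /nbhs_ballP[d /= d0] H.
have {}H (h : V) : `|h| < d -> differentiable f (h + x) /\
    `|'D_u f (h + x) - ('D_u f x + 'd ('D_u f) x h)| <= e / M * `|h|.
  by move=> hd; apply: H; rewrite -ball_normE /= sub0r normrN.
near=> t.
have t0 : 0 < t by near: t; exact: nbhs_right_gt.
have tM : t * M < d.
  by rewrite -ltr_pdivlMr//; near: t; apply: nbhs_right_lt; rewrite divr_gt0.
have small s : 0 <= s <= t ->
    `|s *: u + t *: v| <= t * (`|u| + `|v|) /\ `|s *: u| <= t * (`|u| + `|v|).
  move=> /andP[s0 st]; rewrite mulrDr !normrZ !(ger0_norm s0); split.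
    rewrite (le_trans (ler_normD _ _))// !normrZ (ger0_norm s0) gtr0_norm//.
    by rewrite lerD2r ler_wpM2r.
  by rewrite (le_trans (ler_wpM2r _ st))// lerDl mulr_ge0// ltW.
have tMd : t * (`|u| + `|v|) < d.
  apply: le_lt_trans tM; rewrite ler_wpM2l ?ltW// /M.
  by have := normr_ge0 u; have := normr_ge0 v; lra.
pose phi s := f (s *: u + (t *: v + x)) - f (s *: u + x).
pose dphi s := 'D_u f (s *: u + (t *: v + x)) - 'D_u f (s *: u + x).
have phiP s : 0 <= s <= t -> is_derive s 1 phi (dphi s).
  move=> /small[s1 s2]; apply: is_deriveB; apply: is_derive_along.
    by rewrite addrA; apply: (H _ _).1; apply: le_lt_trans tMd.
  by apply: (H _ _).1; apply: le_lt_trans tMd.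
have [c ct E] : exists2 c, c \in `]0, t[%R & phi t - phi 0 = dphi c * (t - 0).
  apply: MVT => // [s|].
    by rewrite in_itv /= => /andP[/ltW s0 /ltW st]; apply: phiP; rewrite s0.
  apply: derivable_within_continuous => s; rewrite in_itv /= => st.
  by have [] := phiP s st.
have {ct} /small[c1 c2] : 0 <= c <= t.
  by move: ct; rewrite in_itv /= => /andP[/ltW -> /ltW ->].
have -> : second_difference f x u v t = phi t - phi 0.
  by rewrite /second_difference /phi !scale0r !add0r; ring.
rewrite E subr0 deriveE//.
have -> : dphi c * t - t ^+ 2 * 'd ('D_u f) x v =
    t * (('D_u f (c *: u + t *: v + x) -
           ('D_u f x + 'd ('D_u f) x (c *: u + t *: v))) -
         ('D_u f (c *: u + x) - ('D_u f x + 'd ('D_u f) x (c *: u)))).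
  have -> : 'd ('D_u f) x (c *: u + t *: v) =
      'd ('D_u f) x (c *: u) + t * 'd ('D_u f) x v by rewrite linearD [X in _ + X]linearZ.
  by rewrite /dphi addrA; ring.
rewrite normrM gtr0_norm// expr2 mulrCA ler_pM2l//.
apply: le_trans (ler_normB _ _) _.
apply: (@le_trans _ _ (e / M * (t * (`|u| + `|v|)) + e / M * (t * (`|u| + `|v|)))).
  apply: lerD; apply: le_trans (H _ _).2 _; rewrite ?ler_pM2l//.
    exact: le_lt_trans tMd.
  exact: le_lt_trans tMd.
have -> : e / M * (t * (`|u| + `|v|)) + e / M * (t * (`|u| + `|v|)) =
    e * t * ((M - 1) / M) by rewrite /M; field; rewrite -/M gt_eqF.
apply: ler_piMr; first by rewrite mulr_ge0// ltW.
by rewrite ler_pdivrMr// mul1r gerBl.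
Unshelve. all: by end_near. Qed.

Lemma quadratic_coefficient_unique (D : R -> R) (k l : R) :
  (forall e, 0 < e -> \forall t \near 0^'+, `|D t - t ^+ 2 * k| <= e * t ^+ 2) ->
  (forall e, 0 < e -> \forall t \near 0^'+, `|D t - t ^+ 2 * l| <= e * t ^+ 2) ->
  k = l.
Proof.
move=> Dk Dl; apply/eqP; rewrite -subr_eq0 -normr_le0; apply/ler_addgt0Pl => e e0.
rewrite addr0; have e20 : 0 < e / 2 by rewrite divr_gt0.
have [t [t0 [H1 H2]]] :=
  filter_ex (filterI (nbhs_right_gt 0) (filterI (Dk _ e20) (Dl _ e20))).
have t20 : 0 < t ^+ 2 by rewrite exprn_gt0.
rewrite -(ler_pM2r t20) -{1}(gtr0_norm t20) -normrM.
have -> : (k - l) * t ^+ 2 = (D t - t ^+ 2 * l) - (D t - t ^+ 2 * k) by ring.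
by rewrite (splitr e) mulrDl (le_trans (ler_normB _ _))// lerD.
Qed.

Lemma derive_comm_real {V : normedModType R} (f : V -> R) (x u v : V) :
  twice_differentiable f x -> 'D_v ('D_u f) x = 'D_u ('D_v f) x.
Proof.
move=> df; apply: (@quadratic_coefficient_unique (second_difference f x u v)).
  by move=> e e0; exact: second_difference_approx.
move=> e e0; have := second_difference_approx v u e0 df.
apply: filterS => t; congr (`|_ - _| <= _).
by rewrite /second_difference [t *: v + (t *: u + x)]addrCA; ring.
Qed.

Lemma derive_comm {V : normedModType R} m n (f : V -> 'M[R]_(m, n)) (x u v : V) :
  twice_differentiable f x -> 'D_v ('D_u f) x = 'D_u ('D_v f) x.
Proof.
move=> df; have [df1 df2] := df; apply/matrixP => i j.
pose g y := f y i j.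
have gE w : {near x, (fun y => 'D_w g y) =1 (fun y => 'D_w f y i j)}.
  by apply: filterS df1 => y dfy; exact: derive_entry.
have dg : twice_differentiable g x.
  split; first by apply: filterS df1 => y dfy; exact: differentiable_entry.
  move=> w; apply: (@near_eq_differentiable _ _ _ (fun y => 'D_w f y i j)).
    by apply: filterS (gE w) => y ->.
  exact: differentiable_entry.
have K w1 w2 : 'D_w1 ('D_w2 f) x i j = 'D_w1 ('D_w2 g) x.
  have d : differentiable (fun y => 'D_w2 f y) x by [].
  by apply: etrans (esym (derive_entry w1 i j d)) _; exact/esym/near_eq_derive.
apply: etrans (K v u) _; apply: etrans (derive_comm_real u v dg) _.
exact/esym/K.
Qed.

End SecondOrder.

(** * Second-order chain rule and indefinite scalar products *)

Section ChainRule.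
Context {R : realType}.

Lemma diff_partial m (W : normedModType R) (f : 'rV[R]_m -> W) (x v : 'rV[R]_m) :
  differentiable f x -> 'd f x v = \sum_(a < m) v 0 a *: partial a f x.
Proof.
move=> df; rewrite {1}(row_sum_delta v) linear_sum; apply: eq_bigr => a _.
by rewrite linearZ /partial deriveE.
Qed.

Lemma derive_comp {V W : normedModType R} m (f : V -> 'rV[R]_m) (g : 'rV[R]_m -> W)
    (x v : V) : differentiable f x -> differentiable g (f x) ->
  'D_v (fun y => g (f y)) x = 'd g (f x) ('D_v f x).
Proof.
move=> df dg; rewrite deriveE; last exact: (differentiable_comp df dg).
by rewrite (_ : (fun y => _) = g \o f)// diff_comp// deriveE.
Qed.

(** Near x the first derivatives of the composite are sums of products of maps
    that are differentiable at x; the formula is the product rule for them. *)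
Lemma twice_differentiable_comp {V : normedModType R} m p q
    (f : V -> 'rV[R]_m) (g : 'rV[R]_m -> 'M[R]_(p, q)) (x : V) :
  twice_differentiable f x -> twice_differentiable g (f x) ->
  twice_differentiable (fun y => g (f y)) x /\
  forall v w, 'D_w ('D_v (fun y => g (f y))) x =
    \sum_(a < m) 'D_w ('D_v f) x 0 a *: partial a g (f x) +
    \sum_(a < m) \sum_(b < m) ('D_w f x 0 b * 'D_v f x 0 a) *:
      partial b (partial a g) (f x).
Proof.
move=> Cf Cg; have df := twice_differentiable1 Cf.
have [nf d2f] := Cf; have [ng d2g] := Cg.
have ngf : {near x, forall y, differentiable g (f y)}.
  exact: (differentiable_continuous df ng).
have E v : {near x, (fun y => \sum_(a < m) 'D_v f y 0 a *: partial a g (f y))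
    =1 (fun y => 'D_v (fun y => g (f y)) y)}.
  near=> y; have dfy : differentiable f y by near: y.
  have dgy : differentiable g (f y) by near: y.
  by rewrite derive_comp// diff_partial.
have d1 v a : differentiable (fun y => 'D_v f y 0 a) x.
  exact: differentiable_entry.
have d2 a : differentiable (fun y => partial a g (f y)) x.
  exact: (differentiable_comp df (d2g _)).
have d3 v a : differentiable (fun y => 'D_v f y 0 a *: partial a g (f y)) x.
  exact: differentiable_scale.
split=> [|v w]; [split|].
- near=> y; have dfy : differentiable f y by near: y.
  have dgy : differentiable g (f y) by near: y.
  exact: (differentiable_comp dfy dgy).
- move=> v; apply: near_eq_differentiable (E v) _.
  exact: differentiable_sumf.
- rewrite -(near_eq_derive _ (E v)) derive_sum_diff// -big_split.
  apply: eq_bigr => a _ /=; rewrite derive_scale// derive_entry//; congr (_ + _).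
  rewrite derive_comp//; last exact: d2g.
  rewrite diff_partial; last exact: d2g.
  by rewrite scaler_sumr; apply: eq_bigr => b _; rewrite scalerA mulrC.
Unshelve. all: by end_near. Qed.

Lemma twice_differentiable_linear_comp {V : normedModType R} m n p q
    (L : {linear 'M[R]_(m, n) -> 'M[R]_(p, q)}) (F : V -> 'M[R]_(m, n)) (x : V) :
  twice_differentiable F x -> twice_differentiable (fun y => L (F y)) x.
Proof.
move=> [dF d2F]; split.
  by apply: filterS dF => y; exact: differentiable_linear_comp.
move=> v; apply: (@near_eq_differentiable _ _ _ (fun y => L ('D_v F y))).
  by apply: filterS dF => y dFy; rewrite derive_linear_comp.
exact: differentiable_linear_comp.
Qed.

Lemma twice_differentiableD {V W : normedModType R} (F G : V -> W) (x : V) :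
  twice_differentiable F x -> twice_differentiable G x ->
  twice_differentiable (fun y => F y + G y) x.
Proof.
move=> [dF d2F] [dG d2G]; split.
  near=> y; apply: differentiableD; by near: y.
move=> v; apply: (@near_eq_differentiable _ _ _ (fun y => 'D_v F y + 'D_v G y)).
  near=> y; apply/esym/deriveD; apply: diff_derivable; by near: y.
exact: differentiableD.
Unshelve. all: by end_near. Qed.

Lemma twice_differentiable_row_mx {V : normedModType R} p q
    (F : V -> 'rV[R]_p) (G : V -> 'rV[R]_q) (x : V) :
  twice_differentiable F x -> twice_differentiable G x ->
  twice_differentiable (fun y => row_mx (F y) (G y)) x.
Proof.
move=> CF CG.
have L1 : linear (fun u : 'rV[R]_p => row_mx u (0 : 'rV[R]_q)).
  by move=> k u v; rewrite scale_row_mx add_row_mx scaler0 addr0.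
have L2 : linear (fun u : 'rV[R]_q => row_mx (0 : 'rV[R]_p) u).
  by move=> k u v; rewrite scale_row_mx add_row_mx scaler0 addr0.
pose l1 : {linear _ -> _} := HB.pack (fun u : 'rV[R]_p => row_mx u (0 : 'rV[R]_q))
  (GRing.isLinear.Build _ _ _ _ _ L1).
pose l2 : {linear _ -> _} := HB.pack (fun u : 'rV[R]_q => row_mx (0 : 'rV[R]_p) u)
  (GRing.isLinear.Build _ _ _ _ _ L2).
rewrite (_ : (fun _ => _) = (fun y => l1 (F y) + l2 (G y))); last first.
  by apply/funext => y /=; rewrite add_row_mx add0r addr0.
by apply: twice_differentiableD; exact: twice_differentiable_linear_comp.
Qed.

Lemma derive_row_mx {V : normedModType R} p q (F : V -> 'rV[R]_p)
    (G : V -> 'rV[R]_q) (x v : V) :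
  differentiable F x -> differentiable G x ->
  differentiable (fun y => row_mx (F y) (G y)) x /\
  'D_v (fun y => row_mx (F y) (G y)) x = row_mx ('D_v F x) ('D_v G x).
Proof.
move=> dF dG.
have d : differentiable (fun y => row_mx (F y) (G y)) x.
  apply: differentiable_mx => i j; case: (split_ordP j) => j' ->.
    rewrite (_ : (fun _ => _) = fun y => F y i j').
      exact: differentiable_entry.
    by apply/funext => y; rewrite row_mxEl.
  rewrite (_ : (fun _ => _) = fun y => G y i j').
    exact: differentiable_entry.
  by apply/funext => y; rewrite row_mxEr.
split=> //; rewrite -[LHS]hsubmxK; congr row_mx.
  rewrite -derive_linear_comp//; congr ('D_v _ x); apply/funext => y /=.
  by rewrite row_mxKl.
rewrite -derive_linear_comp//; congr ('D_v _ x); apply/funext => y /=.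
by rewrite row_mxKr.
Qed.

End ChainRule.

Section Forms.
Context {R : realType} {d : nat} (s : nat).
Implicit Types u v w : 'rV[R]_d.

Lemma pscal_sym u v : pscal s u v = pscal s v u.
Proof. by apply: eq_bigr => j _; rewrite mulrAC. Qed.

Lemma pscalDl u v w : pscal s (u + v) w = pscal s u w + pscal s v w.
Proof.
by rewrite -big_split; apply: eq_bigr => j _; rewrite mxE mulrDr mulrDl.
Qed.

Lemma pscalZl k u v : pscal s (k *: u) v = k * pscal s u v.
Proof. by rewrite mulr_sumr; apply: eq_bigr => j _; rewrite mxE; ring. Qed.

Lemma pscalNl u v : pscal s (- u) v = - pscal s u v.
Proof. by rewrite -scaleN1r pscalZl mulN1r. Qed.

Lemma pscalNr u v : pscal s u (- v) = - pscal s u v.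
Proof. by rewrite pscal_sym pscalNl pscal_sym. Qed.

Lemma pscal0l u : pscal s 0 u = 0.
Proof. by rewrite -(scale0r 0) pscalZl mul0r. Qed.

Lemma pscal_suml I (r : seq I) (F : I -> 'rV[R]_d) v :
  pscal s (\sum_(i <- r) F i) v = \sum_(i <- r) pscal s (F i) v.
Proof.
by apply: (big_morph (fun u => pscal s u v)) => [x y|]; rewrite ?pscalDl ?pscal0l.
Qed.

(** The real part of the indefinite Hermitian product of C^d, read in the
    coordinates (Re z, Im z) of R^(d + d). *)
Definition cscal (u v : 'rV[R]_(d + d)) : R :=
  pscal s (lsubmx u) (lsubmx v) + pscal s (rsubmx u) (rsubmx v).

(** Multiplication by i in the same coordinates. *)
Definition imulr (u : 'rV[R]_(d + d)) : 'rV[R]_(d + d) :=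
  row_mx (- rsubmx u) (lsubmx u).

End Forms.

Section ComplexForm.
Context {R : realType} {d : nat} (s : nat).
Implicit Types u v w : 'rV[R]_(d + d).
Local Notation B := (@cscal R d s).
Local Notation J := (@imulr R d).

Lemma cscal_sym u v : B u v = B v u.
Proof. by rewrite /cscal pscal_sym (pscal_sym s (rsubmx u)). Qed.

Lemma cscalDl u v w : B (u + v) w = B u w + B v w.
Proof. by rewrite /cscal !linearD !pscalDl addrACA. Qed.

Lemma cscalZl k u v : B (k *: u) v = k * B u v.
Proof. by rewrite /cscal !linearZ !pscalZl mulrDr. Qed.

Lemma cscalDr u v w : B u (v + w) = B u v + B u w.
Proof. by rewrite cscal_sym cscalDl !(cscal_sym u). Qed.

Lemma cscalZr k u v : B u (k *: v) = k * B u v.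
Proof. by rewrite cscal_sym cscalZl cscal_sym. Qed.

Lemma cscalNl u v : B (- u) v = - B u v.
Proof. by rewrite -scaleN1r cscalZl mulN1r. Qed.

Lemma cscalNr u v : B u (- v) = - B u v.
Proof. by rewrite cscal_sym cscalNl cscal_sym. Qed.

Lemma cscal0l u : B 0 u = 0.
Proof. by rewrite -(scale0r 0) cscalZl mul0r. Qed.

Lemma cscal_suml I (r : seq I) (F : I -> 'rV[R]_(d + d)) v :
  B (\sum_(i <- r) F i) v = \sum_(i <- r) B (F i) v.
Proof.
by apply: (big_morph (fun u => B u v)) => [x y|]; rewrite ?cscalDl ?cscal0l.
Qed.

Lemma imulrD u v : J (u + v) = J u + J v.
Proof. by rewrite /imulr !linearD/= add_row_mx. Qed.

Lemma imulrZ k u : J (k *: u) = k *: J u.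
Proof. by rewrite /imulr !linearZ/= scale_row_mx scalerN. Qed.

Lemma imulr_is_linear : linear J.
Proof. by move=> k u v; rewrite imulrD imulrZ. Qed.

HB.instance Definition _ := GRing.isLinear.Build R 'rV[R]_(d + d)
  'rV[R]_(d + d) _ J imulr_is_linear.

Lemma imulrK u : J (J u) = - u.
Proof.
by rewrite /imulr row_mxKl row_mxKr -[in RHS](hsubmxK u) opp_row_mx.
Qed.

Lemma cscalJ u v : B (J u) (J v) = B u v.
Proof.
by rewrite /cscal /imulr !row_mxKl !row_mxKr pscalNl pscalNr opprK addrC.
Qed.

Lemma cscalJl u v : B (J u) v = - B u (J v).
Proof. by rewrite -cscalJ imulrK cscalNl. Qed.

Lemma cscal_imulr_self u : B u (J u) = 0.
Proof. by have := cscalJl u u; rewrite cscal_sym; lra. Qed.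

Lemma cscal_row_mx (x y x' y' : 'rV[R]_d) :
  B (row_mx x y) (row_mx x' y') = pscal s x x' + pscal s y y'.
Proof. by rewrite /cscal !row_mxKl !row_mxKr.
Qed.

Lemma imulr_row_mx (x y : 'rV[R]_d) : J (row_mx x y) = row_mx (- y) x.
Proof. by rewrite /imulr row_mxKl row_mxKr.
Qed.

Lemma cscal_toC u v : pscalC s (toC u) (toC v) = B u v.
Proof.
rewrite /pscalC /cscal /pscal -big_split raddf_sum.
by apply: eq_bigr => j _; rewrite /toC /cplx !mxE /=; ring.
Qed.

Lemma imul_toC u : imul (toC u) = toC (J u).
Proof.
apply/rowP => j; rewrite /imul /toC /cplx /imulr row_mxKl row_mxKr !mxE /=.
by apply/eqP; rewrite eq_complex /=; apply/andP; split; apply/eqP; ring.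
Qed.

Lemma toCD u v : toC (u + v) = toC u + toC v.
Proof.
apply/rowP => j; rewrite /toC /cplx !mxE /=.
by apply/eqP; rewrite eq_complex /= !eqxx.
Qed.

Lemma toCZ k u : toC (k *: u) = k%:C *: toC u.
Proof.
apply/rowP => j; rewrite /toC /cplx !mxE /=.
by apply/eqP; rewrite eq_complex /=; apply/andP; split; apply/eqP; ring.
Qed.

Lemma ofCK : cancel (@ofC R d) toC.
Proof.
move=> z; apply/rowP => j; rewrite /toC /ofC row_mxKl row_mxKr !mxE.
by case: (z _ _).
Qed.

Lemma toCK : cancel (@toC R d) ofC.
Proof.
move=> u; rewrite -[RHS]hsubmxK /ofC /toC; congr row_mx;
  by apply/rowP => j; rewrite !mxE.
Qed.

Lemma differentiable_cscal {V : normedModType R} (F G : V -> 'rV[R]_(d + d))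
    (x : V) : differentiable F x -> differentiable G x ->
  differentiable (fun y => B (F y) (G y)) x.
Proof.
by move=> dF dG; apply: differentiableD; apply: differentiable_pscal;
  exact: differentiable_linear_comp.
Qed.

Lemma derive_cscal {V : normedModType R} (F G : V -> 'rV[R]_(d + d))
    (x v : V) : differentiable F x -> differentiable G x ->
  'D_v (fun y => B (F y) (G y)) x = B ('D_v F x) (G x) + B (F x) ('D_v G x).
Proof.
move=> dF dG; rewrite deriveD; last 2 first.
- by apply/diff_derivable/differentiable_pscal; exact: differentiable_linear_comp.
- by apply/diff_derivable/differentiable_pscal; exact: differentiable_linear_comp.
rewrite !derive_pscal; try exact: differentiable_linear_comp.
by rewrite !derive_linear_comp// addrACA.
Qed.

End ComplexForm.

(** * The Levi-Civita connection of a quotient by the Hopf circle *)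

Section HopfQuotient.
Context {R : realType} {d m : nat} (s : nat).
Variable (Q : 'rV[R]_m -> 'rV[R]_(d + d)).
Local Notation B := (@cscal R d s).
Local Notation J := (@imulr R d).
Local Notation q_ a := (partial a Q).
Local Opaque derive diff cscal imulr.

(** The horizontal part of dQ(w), where Q lifts a local parametrization of the
    quotient of the unit sphere of the form by the circle. *)
Definition hopf_lift (y w : 'rV[R]_m) : 'rV[R]_(d + d) :=
  'd Q y w + B ('d Q y w) (Q y) *: Q y + B ('d Q y w) (J (Q y)) *: J (Q y).

Definition hopf_metric (y : 'rV[R]_m) : 'M[R]_m :=
  \matrix_(a, b) B (hopf_lift y (delta_mx 0 a)) (hopf_lift y (delta_mx 0 b)).

Lemma hopf_lift_is_linear y : linear (hopf_lift y).
Proof.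
move=> k u v; apply/rowP => j.
by rewrite /hopf_lift linearP !cscalDl !cscalZl !mxE; ring.
Qed.

HB.instance Definition _ y := GRing.isLinear.Build R 'rV[R]_m 'rV[R]_(d + d) _
  (hopf_lift y) (hopf_lift_is_linear y).

Lemma hopf_lift_sum y w :
  hopf_lift y w = \sum_(a < m) w 0 a *: hopf_lift y (delta_mx 0 a).
Proof.
rewrite {1}(row_sum_delta w) linear_sum.
by apply: eq_bigr => a _; rewrite linearZ.
Qed.

Lemma hopf_metricE y u w :
  B (hopf_lift y u) (hopf_lift y w) = (u *m hopf_metric y *m w^T) 0 0.
Proof.
rewrite (hopf_lift_sum y u) (hopf_lift_sum y w) cscal_suml.
rewrite mxE.
under [RHS]eq_bigr => b _ do rewrite mxE mulr_suml.
rewrite [RHS]exchange_big /=.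
apply: eq_bigr => a _; rewrite cscalZl cscal_sym cscal_suml mulr_sumr.
apply: eq_bigr => b _; rewrite cscalZl !mxE cscal_sym; ring.
Qed.

Lemma hopf_metric_sym y : (hopf_metric y)^T = hopf_metric y.
Proof. by apply/matrixP => a b; rewrite !mxE cscal_sym. Qed.

Section AtPoint.
Variable y : 'rV[R]_m.
Hypothesis CQ : twice_differentiable Q y.
Hypothesis QQ : {near y, forall y, B (Q y) (Q y) = -1}.

Let near_derQ v : {near y, forall y, B ('D_v Q y) (Q y) = 0}.
Proof.
have [dQ _] := CQ; near=> y'.
have : 'D_v (fun y => B (Q y) (Q y)) y' = 'D_v (cst (-1 : R)) y'.
  by apply: near_eq_derive; near: y'; exact: (near_join QQ).
rewrite derive_cst => E.
have dQy : differentiable Q y' by near: y'.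
by move: E; rewrite derive_cscal// [B (Q _) _]cscal_sym; lra.
Unshelve. all: by end_near. Qed.

Lemma hopf_liftE v : {near y, forall y, hopf_lift y v =
  'D_v Q y + B ('D_v Q y) (J (Q y)) *: J (Q y)}.
Proof.
have [dQ _] := CQ; near=> y'; have dQy : differentiable Q y' by near: y'.
rewrite /hopf_lift -deriveE//.
have -> : B ('D_v Q y') (Q y') = 0 by near: y'; exact: near_derQ.
by rewrite scale0r addr0.
Unshelve. all: by end_near. Qed.

Lemma hopf_lift_orth v :
  B (hopf_lift y v) (Q y) = 0 /\ B (hopf_lift y v) (J (Q y)) = 0.
Proof.
have JQ : B (J (Q y)) (Q y) = 0 by rewrite cscal_sym cscal_imulr_self.
rewrite (nbhs_singleton (hopf_liftE v)) !cscalDl !cscalZl JQ.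
rewrite (nbhs_singleton (near_derQ v)) cscalJ (nbhs_singleton QQ).
by split; ring.
Qed.

(** The Christoffel symbols of the first kind. A horizontal lift transported
    along the quotient is Q up to a phase, and the two terms in J undo the
    rotation of this phase. *)
Definition hopf_christoffel (u v w : 'rV[R]_m) : R :=
  B ('D_u ('D_v Q) y + B ('D_v Q y) (J (Q y)) *: J ('D_u Q y)
     + B ('D_u Q y) (J (Q y)) *: J ('D_v Q y)) (hopf_lift y w).

Lemma hopf_christoffel_sym u v w :
  hopf_christoffel u v w = hopf_christoffel v u w.
Proof.
apply: (congr1 (fun z => B z _)); apply: etrans (addrAC _ _ _) _.
exact: (congr1 (fun z => z + _ + _) (derive_comm v u CQ)).
Qed.

Let hopf_christoffel_vec (quv qu qv q h : 'rV[R]_(d + d)) (r tu tv : R) :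
  B h q = 0 -> B h (J q) = 0 ->
  B (quv + (r *: J q + tv *: J qu)) h =
  B (quv + tv *: J qu + tu *: J qv) h - tu * B (J (qv + tv *: J q)) h.
Proof.
move=> o1 o2; rewrite imulrD imulrZ imulrK !cscalDl !cscalZl !cscalNl.
by rewrite ![B _ h]cscal_sym o1 o2; ring.
Qed.

(** Metric compatibility: the terms coming from the rotation of the phase
    cancel because J is skew. *)
Lemma derive_hopf_metric u v w :
  'D_u (fun y => B (hopf_lift y v) (hopf_lift y w)) y =
  hopf_christoffel u v w + hopf_christoffel u w v.
Proof.
have dQ := twice_differentiable1 CQ; have [_ d2Q] := CQ.
pose h v y := 'D_v Q y + B ('D_v Q y) (J (Q y)) *: J (Q y).
have E : {near y, (fun y => B (hopf_lift y v) (hopf_lift y w)) =1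
    (fun y => B (h v y) (h w y))}.
  apply: filterS2 (hopf_liftE v) (hopf_liftE w) => y' Ev Ew.
  exact (congr2 (fun a b => B a b) Ev Ew).
rewrite (near_eq_derive _ E).
have dJ : differentiable (fun y => J (Q y)) y.
  exact: differentiable_linear_comp.
have dth v' : differentiable (fun y => B ('D_v' Q y) (J (Q y))) y.
  exact: differentiable_cscal.
have dh v' : differentiable (h v') y.
  by apply: differentiableD => //; exact: differentiable_scale.
(* The difference with hopf_christoffel is skew in v' and w'. *)
have key v' w' : B ('D_u (h v') y) (hopf_lift y w') =
    hopf_christoffel u v' w' -
    B ('D_u Q y) (J (Q y)) * B (J (hopf_lift y v')) (hopf_lift y w').
  rewrite deriveD; last 2 first.
  - exact: diff_derivable.
  - by apply: diff_derivable; exact: differentiable_scale.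
  rewrite derive_scale// derive_linear_comp// /hopf_christoffel.
  have [hq hJq] := hopf_lift_orth w'; rewrite (nbhs_singleton (hopf_liftE v')).
  exact (hopf_christoffel_vec _ _ _ _ _ _ hq hJq).
rewrite derive_cscal//.
rewrite /= -[h w y](nbhs_singleton (hopf_liftE w)).
rewrite -[h v y](nbhs_singleton (hopf_liftE v)).
rewrite key [X in _ + X]cscal_sym key cscalJl [B (hopf_lift y v) _]cscal_sym; ring.
Unshelve. all: by end_near. Qed.

(** Koszul's argument: a candidate that is symmetric in its first two
    arguments and compatible with the metric solves for the same combination
    of derivatives of the metric as the Christoffel symbols. *)
Lemma christoffel_hopf_metric (a b e : 'I_m) : hopf_metric y \in unitmx ->
  \sum_(c < m) christoffel hopf_metric y a b c * hopf_metric y c e =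
  hopf_christoffel (delta_mx 0 a) (delta_mx 0 b) (delta_mx 0 e).
Proof.
move=> gu.
have dg a' b' c' : partial a' (fun y => hopf_metric y b' c') y =
    hopf_christoffel (delta_mx 0 a') (delta_mx 0 b') (delta_mx 0 c') +
    hopf_christoffel (delta_mx 0 a') (delta_mx 0 c') (delta_mx 0 b').
  rewrite -derive_hopf_metric /partial; congr ('D_ _ _ y).
  by apply/funext => y'; rewrite mxE.
pose C := hopf_christoffel (delta_mx 0 a) (delta_mx 0 b).
transitivity (\sum_(c < m) \sum_(f < m) C (delta_mx 0 f) *
    (invmx (hopf_metric y) c f * hopf_metric y c e)).
  apply: eq_bigr => c _; rewrite /christoffel -mulrA mulr_suml mulr_sumr.
  apply: eq_bigr => f _; rewrite !dg.
  rewrite (hopf_christoffel_sym (delta_mx 0 b) (delta_mx 0 a)).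
  rewrite (hopf_christoffel_sym (delta_mx 0 f) (delta_mx 0 a)).
  rewrite (hopf_christoffel_sym (delta_mx 0 f) (delta_mx 0 b)) /C.
  by field.
rewrite exchange_big /= -/(C _).
transitivity (\sum_(f < m) C (delta_mx 0 f) * (f == e)%:R).
  apply: eq_bigr => f _; rewrite -mulr_sumr; congr (_ * _).
  have := mulmxV gu => /matrixP/(_ e f); rewrite !mxE eq_sym => <-.
  apply: eq_bigr => c _; rewrite mulrC; congr (_ * _).
  by rewrite -[in LHS]hopf_metric_sym mxE.
rewrite (bigD1 e)//= eqxx mulr1 big1 ?addr0// => f /negPf ->.
by rewrite mulr0.
Qed.

End AtPoint.

Let mulr_swap (k p q g : R) : k * p * q * g = p * q * (k * g).
Proof. by ring. Qed.

(** The vectors q and q2 stand for the first and second partial derivatives of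
    Q, fi and fj for those of the map into the quotient, and th for the
    rotation of the phase: both sides of the second-order chain rule paired
    with a fixed vector. *)
Lemma cscal_second_order (F fi fj th : 'I_m -> R) (q : 'I_m -> 'rV[R]_(d + d))
    (q2 : 'I_m -> 'I_m -> 'rV[R]_(d + d)) (H : 'rV[R]_(d + d)) :
  B (\sum_a F a *: q a + \sum_a \sum_b (fi b * fj a) *: q2 b a
     + (\sum_a fj a * th a) *: J (\sum_a fi a *: q a)
     + (\sum_a fi a * th a) *: J (\sum_a fj a *: q a)) H =
  \sum_a F a * B (q a) H + \sum_a \sum_b fi a * fj b *
    B (q2 a b + th b *: J (q a) + th a *: J (q b)) H.
Proof.
rewrite !cscalDl !cscalZl !linear_sum !cscal_suml -!addrA; congr (_ + _).
  by apply: eq_bigr => a _; rewrite cscalZl.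
rewrite !mulr_suml.
under eq_bigr => a _ do rewrite cscal_suml.
rewrite exchange_big /=.
under [X in _ + (X + _)]eq_bigr => a _ do rewrite mulr_sumr.
under [X in _ + (_ + X)]eq_bigr => a _ do rewrite mulr_sumr.
rewrite [X in _ + (X + _)]exchange_big /= -!big_split; apply: eq_bigr => a _ /=.
rewrite -!big_split; apply: eq_bigr => b _ /=.
by rewrite !imulrZ !cscalDl !cscalZl; ring.
Qed.

Section Covariant.
Variables (n : nat) (f : 'rV[R]_n -> 'rV[R]_m) (x : 'rV[R]_n).
Hypothesis Cf : twice_differentiable f x.
Hypothesis CQ : twice_differentiable Q (f x).
Hypothesis QQ : {near f x, forall y, B (Q y) (Q y) = -1}.
Hypothesis gu : hopf_metric (f x) \in unitmx.

(** The right-hand side only involves the curve of lifts z = Q o f and not the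
    chart: covariant derivatives along f can be computed on lifts. *)
Lemma hopf_lift_covariant_derivative (i j : 'I_n) (w : 'rV[R]_m) :
  let z := fun x => Q (f x) in
  B (hopf_lift (f x) (covariant_derivative hopf_metric f x i j))
    (hopf_lift (f x) w) =
  B (partial i (partial j z) x
     + B (partial j z x) (J (z x)) *: J (partial i z x)
     + B (partial i z x) (J (z x)) *: J (partial j z x)) (hopf_lift (f x) w).
Proof.
move=> z; have df := twice_differentiable1 Cf; have [_ d2f] := Cf.
have dQ := twice_differentiable1 CQ.
have zE v : 'D_v z x = \sum_(a < m) 'D_v f x 0 a *: q_ a (f x).
  by rewrite derive_comp// diff_partial.
have [_ zzE] := twice_differentiable_comp Cf CQ.
rewrite (hopf_lift_sum _ w) ![B _ (\sum_(i < m) _)]cscal_sym !cscal_suml.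
apply: eq_bigr => e _; rewrite !cscalZl; congr (_ * _); rewrite cscal_sym [RHS]cscal_sym.
pose th a := B (q_ a (f x)) (J (Q (f x))).
have thE v : B ('D_v z x) (J (z x)) = \sum_(a < m) 'D_v f x 0 a * th a.
  by rewrite zE cscal_suml; apply: eq_bigr => a _; rewrite cscalZl.
rewrite [B (partial j z x) _]thE [B (partial i z x) _]thE.
rewrite [partial i z x]zE [partial j z x]zE [partial i (partial j z) x]zzE.
rewrite cscal_second_order.
set H := hopf_lift (f x) (delta_mx 0 e).
have -> : B (hopf_lift (f x) (covariant_derivative hopf_metric f x i j)) H =
    \sum_(c < m) covariant_derivative hopf_metric f x i j 0 c *
      hopf_metric (f x) c e.
  rewrite hopf_lift_sum cscal_suml; apply: eq_bigr => c _.
  by rewrite cscalZl [hopf_metric _ _ _]mxE.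
transitivity (\sum_(c < m) ('D_(delta_mx 0 i) ('D_(delta_mx 0 j) f) x 0 c *
    hopf_metric (f x) c e) + \sum_(a < m) \sum_(b < m)
    partial i f x 0 a * partial j f x 0 b *
    hopf_christoffel (f x) (delta_mx 0 a) (delta_mx 0 b) (delta_mx 0 e)).
  under eq_bigr => c _ do rewrite mxE mulrDl /partial derive_entry//.
  rewrite big_split /=; congr (_ + _).
  under eq_bigr => c _ do rewrite mulr_suml.
  rewrite exchange_big; apply: eq_bigr => a _ /=.
  under eq_bigr => c _ do rewrite mulr_suml.
  rewrite exchange_big; apply: eq_bigr => b _ /=.
  rewrite -christoffel_hopf_metric// mulr_sumr; apply: eq_bigr => c _.
  exact (mulr_swap _ _ _ _).
congr (_ + _).
apply: eq_bigr => c _; congr (_ * _).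
rewrite mxE -/H (nbhs_singleton (hopf_liftE CQ QQ _)) cscalDl cscalZl.
by rewrite [B (J _) H]cscal_sym (hopf_lift_orth CQ QQ _).2 mulr0 addr0.
Qed.

End Covariant.
End HopfQuotient.

(** * Orthogonal complements and multiplication by a phase *)

Lemma derive_eq_on_open {R : realType} {V W : normedModType R} (N : set V)
    (F G : V -> W) : open N -> (forall y, N y -> F y = G y) ->
  forall y v, N y -> 'D_v F y = 'D_v G y.
Proof.
move=> oN FG y v Ny; apply: near_eq_derive.
exact: filterS FG (open_nbhs_nbhs (conj oN Ny)).
Qed.

Section LinearAlgebra.
Context {R : realType}.

(** A vector in the kernel of g is isotropic for g. *)
Lemma anisotropic_unitmx m (g : 'M[R]_m) :
  (forall v : 'rV[R]_m, v *m g *m v^T = 0 -> v = 0) -> g \in unitmx.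
Proof.
move=> g0; rewrite -row_free_unit; apply: inj_row_free => v vg.
by apply: g0; rewrite vg mul0mx.
Qed.

Definition sig_mx d (s : nat) : 'M[R]_d := diag_mx (\row_j signature s j).

Lemma pscal_mx d s (u v : 'rV[R]_d) : pscal s u v = (u *m sig_mx d s *m v^T) 0 0.
Proof.
rewrite mxE; apply: eq_bigr => j _; rewrite mul_mx_diag !mxE; congr (_ * _).
exact: mulrC.
Qed.

Lemma pscal_eq0_mx d s (u v : 'rV[R]_d) :
  pscal s u v = 0 -> u *m (sig_mx d s *m v^T) = 0.
Proof.
by move=> uv; apply/matrixP => i j; rewrite !ord1 mulmxA -pscal_mx uv mxE.
Qed.

(** Dimension count: a and b span a plane on which the form is nondegenerate,
    so their orthogonal complement has the rank n of D. *)
Lemma orthogonal_complement n (D : 'M[R]_(n, n.+2)) (a b w : 'rV[R]_n.+2) :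
  row_free D -> pscal 2 a a = -1 -> pscal 2 b b = -1 -> pscal 2 b a = 0 ->
  (forall v, pscal 2 a (v *m D) = 0) -> (forall v, pscal 2 b (v *m D) = 0) ->
  pscal 2 a w = 0 -> pscal 2 b w = 0 -> exists v, w = v *m D.
Proof.
move=> fD aa bb ba aD bD aw bw.
pose K := sig_mx n.+2 2 *m (col_mx a b)^T.
have wK u : pscal 2 a u = 0 -> pscal 2 b u = 0 -> u *m K = 0.
  move=> au bu; rewrite /K tr_col_mx mul_mx_row mul_mx_row.
  by rewrite !pscal_eq0_mx ?row_mx0// pscal_sym.
have rK : \rank K = 2.
  apply/eqP; rewrite -mxrank_tr; apply: (inj_row_free (A := K^T)) => v.
  rewrite /K trmx_mul trmxK tr_diag_mx -[v]hsubmxK.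
  set p := lsubmx v; set q := rsubmx v.
  rewrite mulmxA mul_row_col => /(congr1 (fun X => (X *m (row_mx a^T b^T)))).
  rewrite mul0mx mul_mx_row -row_mx0 => /eq_row_mx[].
  rewrite (mx11_scalar p) (mx11_scalar q) !mul_scalar_mx.
  move=> /matrixP/(_ 0 0); rewrite -pscal_mx [RHS]mxE => e1.
  move=> /matrixP/(_ 0 0); rewrite -pscal_mx [RHS]mxE => e2.
  move: e1 e2; rewrite !pscalDl !pscalZl aa bb ba (pscal_sym 2 a b) ba => e1 e2.
  have -> : p 0 0 = 0 by lra.
  have -> : q 0 0 = 0 by lra.
  by rewrite raddf0 row_mx0.
have DK : (D <= kermx K)%MS.
  apply/sub_kermxP/row_matrixP => i; rewrite row_mul row0 rowE.
  by apply: wK; [exact: aD|exact: bD].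
have := mxrank_leqif_sup DK => /leqifP.
rewrite mxrank_ker rK (eqP fD) subn2 /= ltnn.
case: ifP => // KD _.
have /(submx_trans)/(_ KD)/submxP[v ->] : (w <= kermx K)%MS.
  by apply/sub_kermxP/wK.
by exists v.
Qed.

End LinearAlgebra.

Section Phase.
Context {R : realType} {d : nat} (s : nat).
Local Notation B := (@cscal R d s).
Local Notation J := (@imulr R d).
Implicit Types u v w : 'rV[R]_(d + d).

(** Multiplication by the complex number k + i l. *)
Definition cmulr (k l : R) (u : 'rV[R]_(d + d)) : 'rV[R]_(d + d) :=
  k *: u + l *: J u.

Lemma cmulrE k l u : cmulr k l u = k *: u + l *: J u.
Proof. by []. Qed.

Lemma cmulr_is_linear k l : linear (cmulr k l).
Proof.
move=> c u v; rewrite /cmulr imulrD imulrZ.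
by apply/rowP => j; rewrite !mxE; ring.
Qed.

HB.instance Definition _ k l := GRing.isLinear.Build R 'rV[R]_(d + d)
  'rV[R]_(d + d) _ (cmulr k l) (cmulr_is_linear k l).

Lemma cmulrJ k l u : J (cmulr k l u) = cmulr k l (J u).
Proof. by rewrite /cmulr imulrD !imulrZ. Qed.

Lemma cmulrK k l u : cmulr k (- l) (cmulr k l u) = (k ^+ 2 + l ^+ 2) *: u.
Proof.
rewrite /cmulr imulrD !imulrZ imulrK.
by apply/rowP => j; rewrite !mxE; ring.
Qed.

Lemma cscal_cmulr k l u v :
  B (cmulr k l u) (cmulr k l v) = (k ^+ 2 + l ^+ 2) * B u v.
Proof.
rewrite /cmulr !cscalDl !cscalDr !cscalZl !cscalZr cscalJ cscalJl.
by ring.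
Qed.

Lemma cmulr_inj k l u v : k ^+ 2 + l ^+ 2 != 0 ->
  cmulr k l u = cmulr k l v -> u = v.
Proof.
move=> kl /(congr1 (cmulr k (- l))); rewrite !cmulrK.
by move=> /(congr1 ( *:%R (k ^+ 2 + l ^+ 2)^-1)); rewrite !scalerA mulVf// !scale1r.
Qed.

(** The real part of the complex bilinear extension of the form; its imaginary
    part is - rscal u (J v), so the quadric is given by rscal u u = rscal u (J
    u) = 0. *)
Definition rscal u v : R :=
  pscal s (lsubmx u) (lsubmx v) - pscal s (rsubmx u) (rsubmx v).

Lemma rscalDl u v w : rscal (u + v) w = rscal u w + rscal v w.
Proof. by rewrite /rscal !linearD !pscalDl; ring. Qed.

Lemma rscalZl k u v : rscal (k *: u) v = k * rscal u v.
Proof. by rewrite /rscal !linearZ !pscalZl; ring. Qed.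

Lemma rscal_sym u v : rscal u v = rscal v u.
Proof. by rewrite /rscal pscal_sym (pscal_sym s (rsubmx u)). Qed.

Lemma rscalJ u v : rscal (J u) v = rscal u (J v).
Proof.
by rewrite /rscal /imulr !row_mxKl !row_mxKr pscalNl pscalNr; ring.
Qed.

Lemma rscalJJ u v : rscal (J u) (J v) = - rscal u v.
Proof.
by rewrite /rscal /imulr !row_mxKl !row_mxKr pscalNl pscalNr; ring.
Qed.
Lemma rscalDr u v w : rscal u (v + w) = rscal u v + rscal u w.
Proof. by rewrite rscal_sym rscalDl !(rscal_sym u). Qed.

Lemma rscalZr k u v : rscal u (k *: v) = k * rscal u v.
Proof. by rewrite rscal_sym rscalZl rscal_sym. Qed.

Lemma derive_rscal {V : normedModType R} (F G : V -> 'rV[R]_(d + d))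
    (x v : V) : differentiable F x -> differentiable G x ->
  'D_v (fun y => rscal (F y) (G y)) x = rscal ('D_v F x) (G x) + rscal (F x) ('D_v G x).
Proof.
move=> dF dG; rewrite deriveB; last 2 first.
- by apply/diff_derivable/differentiable_pscal; exact: differentiable_linear_comp.
- by apply/diff_derivable/differentiable_pscal; exact: differentiable_linear_comp.
rewrite !derive_pscal; try exact: differentiable_linear_comp.
by rewrite !derive_linear_comp// /rscal; ring.
Qed.

End Phase.

Section PhaseAlgebra.
Context {R : realType} {d : nat} (s : nat).
Local Notation B := (@cscal R d s).
Local Notation J := (@imulr R d).

Lemma cscal_cmulr_unit k l (q : 'rV[R]_(d + d)) : B q q = -1 ->
  B (cmulr k l q) q = - k /\ B (cmulr k l q) (J q) = - l.
Proof.
move=> qq; rewrite /cmulr !cscalDl !cscalZl cscalJ qq cscal_imulr_self.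
by rewrite [B (J q) q]cscal_sym cscal_imulr_self; split; ring.
Qed.

(** As k + i l does not vanish, q and (k + i l) q span the same complex line.
    *)
Lemma cmulr_orth k l (u q : 'rV[R]_(d + d)) : k ^+ 2 + l ^+ 2 = 2 ->
  B u (cmulr k l q) = 0 -> B u (J (cmulr k l q)) = 0 ->
  B u q = 0 /\ B u (J q) = 0.
Proof.
move=> kl; rewrite /cmulr imulrD !imulrZ imulrK !cscalDr !cscalZr cscalNr.
move=> e1 e2.
have e3 : l * B u q - k * B u (J q) = 0 by move: e2; lra.
have h1 : 2 * B u q = k * (k * B u q + l * B u (J q)) +
    l * (l * B u q - k * B u (J q)) by rewrite -kl; ring.
have h2 : 2 * B u (J q) = l * (k * B u q + l * B u (J q)) -
    k * (l * B u q - k * B u (J q)) by rewrite -kl; ring.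
by move: h1 h2; rewrite e1 e3 !mulr0 addr0 subr0 => h1 h2; split; lra.
Qed.

(** Product rule for the lift (k + i l) q when the phase k + i l turns at
    speed t: the derivative of the phase completes that of q to a horizontal
    vector. *)
Lemma cmulr_leibniz (k l t : R) (q qv : 'rV[R]_(d + d)) :
  - l * t *: q + k *: qv + (k * t *: J q + l *: J qv) =
  cmulr k l (qv + t *: J q).
Proof.
rewrite /cmulr imulrD imulrZ imulrK.
by apply/rowP => j; rewrite !mxE; ring.
Qed.

(** Second-order analogue: the rotation speeds tu and tv are absorbed, up to
    multiples of the vertical vectors q and J q. *)
Lemma cmulr_leibniz2 (k l tu tv r : R) (q qu qv quv : 'rV[R]_(d + d)) :
  - l * tu *: (qv + tv *: J q) + k *: (quv + (r *: J q + tv *: J qu)) +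
  (k * tu *: J (qv + tv *: J q) + l *: J (quv + (r *: J q + tv *: J qu))) =
  cmulr k l (quv + tv *: J qu + tu *: J qv) +
  (- (k * tu * tv) - l * r) *: q + (k * r - l * tu * tv) *: J q.
Proof.
rewrite /cmulr !imulrD !imulrZ !imulrK.
by apply/rowP => j; rewrite !mxE; ring.
Qed.

Lemma rscal_cmulr_eq0 k l (u v : 'rV[R]_(d + d)) :
  rscal s u v = 0 -> rscal s u (J v) = 0 ->
  rscal s (cmulr k l u) (cmulr k l v) = 0.
Proof.
move=> e1 e2; rewrite !cmulrE !rscalDl !rscalDr !rscalZl !rscalZr rscalJJ rscalJ.
by rewrite e1 e2; ring.
Qed.

Lemma rscal_row_mx (u v u' v' : 'rV[R]_d) :
  rscal s (row_mx u v) (row_mx u' v') = pscal s u u' - pscal s v v'.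
Proof. by rewrite /rscal !row_mxKl !row_mxKr. Qed.

Lemma rscalNr (u v : 'rV[R]_(d + d)) : rscal s u (- v) = - rscal s u v.
Proof. by rewrite -scaleN1r rscalZr mulN1r. Qed.

(** The Hermitian form and the bilinear form give the sum and the difference
    of the same pairings of real and imaginary parts. *)
Lemma orthogonal_components (u v a b : 'rV[R]_d) :
  let W := row_mx u v in let q := row_mx a b in
  B W q = 0 -> B W (J q) = 0 -> rscal s W q = 0 -> rscal s W (J q) = 0 ->
  [/\ pscal s a u = 0, pscal s b u = 0, pscal s a v = 0 & pscal s b v = 0].
Proof.
move=> W q; rewrite /W /q imulr_row_mx !cscal_row_mx !rscal_row_mx !pscalNr.
by rewrite ![pscal s a _]pscal_sym ![pscal s b _]pscal_sym; split; lra.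
Qed.

Section RealPart.
Variables (k l : R) (X Y : 'rV[R]_(d + d)) (au bu av bv : 'rV[R]_d).
Hypotheses (kl : k ^+ 2 + l ^+ 2 = 2) (EY : cmulr k l Y = row_mx av bv).

Lemma cscal_from_phase : cmulr k l X = row_mx au bu ->
  B X Y = 2^-1 * (pscal s au av + pscal s bu bv).
Proof.
move=> EX; rewrite -cscal_row_mx -EX -EY cscal_cmulr kl mulrA mulVf//.
by rewrite mul1r.
Qed.

Lemma cscalJ_from_phase : cmulr k l X = row_mx au bu ->
  B (J X) Y = 2^-1 * (pscal s au bv - pscal s bu av).
Proof.
move=> EX; have -> : pscal s au bv - pscal s bu av = B (J (row_mx au bu)) (row_mx av bv).
  by rewrite imulr_row_mx cscal_row_mx pscalNl addrC.
by rewrite -EX -EY cmulrJ cscal_cmulr kl mulrA mulVf// mul1r.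
Qed.

(** Multiples of the vertical vectors q and J q are invisible to a horizontal
    vector. *)
Lemma cscalJ_from_phase_mod (r r' : R) (q : 'rV[R]_(d + d)) :
  row_mx au bu = cmulr k l X + r *: q + r' *: J q ->
  B (row_mx av bv) q = 0 -> B (row_mx av bv) (J q) = 0 ->
  B X (J Y) = - (2^-1 * (pscal s au bv - pscal s bu av)).
Proof.
move=> EX e1 e2; rewrite -[B X _]opprK -cscalJl; congr (- _).
have -> : pscal s au bv - pscal s bu av = B (J (row_mx au bu)) (row_mx av bv).
  by rewrite imulr_row_mx cscal_row_mx pscalNl addrC.
rewrite EX (imulrD _ (r' *: J q)) (imulrD _ (r *: q)) !imulrZ (imulrK q).
rewrite !cscalDl !cscalZl cscalNl.
rewrite ![B _ (row_mx av bv)]cscal_sym e1 e2 cscal_sym -EY cmulrJ cscal_cmulr kl.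
by rewrite oppr0 !mulr0 !addr0 mulrA mulVf// mul1r.
Qed.

End RealPart.

End PhaseAlgebra.

(** * Determinants of complex matrices and continuous arguments *)

Section ComplexMatrices.
Context {R : realType}.
Local Notation C := (R[i]).
Local Notation im := ((0 : R) +i* 1).

Definition cplx_mx {m n} (X Y : 'M[R]_(m, n)) : 'M[R[i]]_(m, n) :=
  \matrix_(i, j) (X i j +i* Y i j).

Lemma cplx_mxE {m n} (X Y : 'M[R]_(m, n)) :
  cplx_mx X Y = map_mx (real_complex R) X + im *: map_mx (real_complex R) Y.
Proof.
apply/matrixP => i j; rewrite !mxE; apply/eqP; rewrite eq_complex /=.
by apply/andP; split; apply/eqP; ring.
Qed.

Lemma cplx_mxM {m n p} (X Y : 'M[R]_(m, n)) (X' Y' : 'M[R]_(n, p)) :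
  cplx_mx X Y *m cplx_mx X' Y' =
  cplx_mx (X *m X' - Y *m Y') (X *m Y' + Y *m X').
Proof.
rewrite !cplx_mxE mulmxDl !mulmxDr -!scalemxAl -!scalemxAr scalerA.
have -> : im * im = -1 :> C.
  by apply/eqP; rewrite eq_complex /=; apply/andP; split; apply/eqP; ring.
rewrite scaleN1r map_mxB map_mxD !map_mxM scalerDr.
by rewrite [X in _ + X = _]addrC addrACA.
Qed.

Lemma Im_trace {n} (X Y : 'M[R]_n) : complex.Im (\tr (cplx_mx X Y)) = \tr Y.
Proof. by rewrite raddf_sum; apply: eq_bigr => i _; rewrite mxE. Qed.

(** With A the first fundamental form and S the shape operator, A + i h times
    1 - i S^T equals A + S A S^T, which makes the inverse W explicit. The
    matrix G holds the scalar products of the derivatives of the tangent frame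
    with the frame itself; its contributions match on both sides because S^T
    commutes past the inverse of A + S A S^T. *)
Lemma trace_identity {n} (A S G dh : 'M[R]_n) :
  let h := S *m A in let metric2 := A + S *m A *m S^T in
  A^T = A -> h^T = h -> metric2 \in unitmx ->
  let M := cplx_mx A h in
  exists W : 'M[R[i]]_n, M *m W = 1%:M /\
    complex.Im (\tr (W *m cplx_mx (G + G^T) dh)) =
    \tr (invmx metric2 *m (dh - S *m G^T - G *m S^T)).
Proof.
move=> h metric2 As hs uI M; pose K := invmx metric2.
have hE : A *m S^T = h by rewrite -hs /h trmx_mul As.
have SI : S *m metric2 = metric2 *m S^T.
  rewrite /metric2 mulmxDr mulmxDl -/h hE; congr (_ + _).
  by rewrite mulmxA; congr (_ *m _); rewrite -{1}hE mulmxA.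
have SK : S^T *m K = K *m S.
  rewrite -[LHS](mulKmx uI) -/K [metric2 *m _]mulmxA -SI !mulmxA -(mulmxA _ metric2) mulmxV//.
  by rewrite mulmx1.
exists (cplx_mx K (- (S^T *m K))); split.
  rewrite /M cplx_mxM !mulmxN opprK [A *m (S^T *m K)]mulmxA hE addNr.
  rewrite [h *m _]mulmxA -mulmxDl -[A + _]/metric2 mulmxV//.
  apply/matrixP => i j; rewrite !mxE; apply/eqP; rewrite eq_complex /=.
  by case: (i == j); rewrite !eqxx.
rewrite cplx_mxM Im_trace mulNmx !mulmxBr !raddfB /= mulmxDr raddfD /=.
rewrite [K *m (S *m _)]mulmxA -SK -/K opprD addrA addrAC; congr (_ - _ - _).
by rewrite mulmxA [RHS]mxtrace_mulC mulmxA.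
Qed.

(** The matrix 1 + i S is - i times the characteristic matrix of S at i. *)
Lemma det_one_plus_i_shape {n} (S : 'M[R]_n) (lam : 'I_n -> R) :
  char_poly S = \prod_(j < n) ('X - (lam j)%:P) ->
  \det (cplx_mx 1%:M S) = \prod_(j < n) ((1 : R) +i* lam j).
Proof.
move=> chi.
have E : cplx_mx 1%:M S =
    (- im) *: map_mx (horner_eval im) (char_poly_mx (map_mx (real_complex R) S)).
  apply/matrixP => i j; rewrite !mxE /horner_eval !hornerE.
  rewrite hornerMn hornerX; apply/eqP; rewrite eq_complex.
  by case: (i == j); rewrite /= ?mulr1n ?mulr0n /=; apply/andP; split; apply/eqP; ring.
have := congr1 (map_poly (real_complex R)) chi.
rewrite map_char_poly rmorph_prod => /(congr1 (horner^~ im)).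
rewrite /char_poly E detZ det_map_mx => chi_i.
rewrite [X in _ * X](_ : _ =
  (\det (char_poly_mx (map_mx (real_complex R) S))).[im])// chi_i.
rewrite horner_prod -[n in (- _) ^+ n]card_ord -prodr_const -big_split /=.
apply: eq_bigr => j _; rewrite rmorphB /= map_polyX map_polyC !hornerE /=.
by apply/eqP; rewrite eq_complex /=; apply/andP; split; apply/eqP; ring.
Qed.

End ComplexMatrices.

Section Jacobi.
Context {R : realType} {V : normedModType R}.
Implicit Types (f g : V -> R[i]) (x v : V).

Definition cdifferentiable f x :=
  differentiable (fun y => complex.Re (f y)) x /\
  differentiable (fun y => complex.Im (f y)) x.

Definition cderive f x v : R[i] :=
  'D_v (fun y => complex.Re (f y)) x +i* 'D_v (fun y => complex.Im (f y)) x.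

Lemma cdifferentiable_cst (k : R[i]) x : cdifferentiable (cst k) x.
Proof. by split; exact: differentiable_cst. Qed.

Lemma cderive_cst (k : R[i]) x v : cderive (cst k) x v = 0.
Proof. by rewrite /cderive !derive_cst. Qed.

Let ReD (z w : R[i]) : complex.Re (z + w) = complex.Re z + complex.Re w.
Proof. by case: z w => [? ?] []. Qed.
Let ImD (z w : R[i]) : complex.Im (z + w) = complex.Im z + complex.Im w.
Proof. by case: z w => [? ?] []. Qed.
Let ReM (z w : R[i]) : complex.Re (z * w) =
  complex.Re z * complex.Re w - complex.Im z * complex.Im w.
Proof. by case: z w => [? ?] []. Qed.
Let ImM (z w : R[i]) : complex.Im (z * w) =
  complex.Re z * complex.Im w + complex.Im z * complex.Re w.
Proof. by case: z w => [? ?] []. Qed.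

Lemma cderiveD f g x v : cdifferentiable f x -> cdifferentiable g x ->
  cdifferentiable (fun y => f y + g y) x /\
  cderive (fun y => f y + g y) x v = cderive f x v + cderive g x v.
Proof.
move=> [f1 f2] [g1 g2].
have E1 : (fun y => complex.Re (f y + g y)) =
    (fun y => complex.Re (f y)) + (fun y => complex.Re (g y)).
  by apply/funext => y; rewrite ReD.
have E2 : (fun y => complex.Im (f y + g y)) =
    (fun y => complex.Im (f y)) + (fun y => complex.Im (g y)).
  by apply/funext => y; rewrite ImD.
split; first by split; rewrite ?E1 ?E2; exact: differentiableD.
by rewrite /cderive E1 E2 !deriveD; try exact: diff_derivable.
Qed.

Lemma cderiveM f g x v : cdifferentiable f x -> cdifferentiable g x ->
  cdifferentiable (fun y => f y * g y) x /\
  cderive (fun y => f y * g y) x v = cderive f x v * g x + f x * cderive g x v.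
Proof.
move=> [f1 f2] [g1 g2].
pose fr y := complex.Re (f y); pose fi y := complex.Im (f y).
pose gr y := complex.Re (g y); pose gi y := complex.Im (g y).
have E1 : (fun y => complex.Re (f y * g y)) = fr * gr - fi * gi.
  by apply/funext => y; rewrite ReM.
have E2 : (fun y => complex.Im (f y * g y)) = fr * gi + fi * gr.
  by apply/funext => y; rewrite ImM.
have d1 : differentiable (fr * gr) x by exact: differentiableM.
have d2 : differentiable (fi * gi) x by exact: differentiableM.
have d3 : differentiable (fr * gi) x by exact: differentiableM.
have d4 : differentiable (fi * gr) x by exact: differentiableM.
split.
  by split; rewrite ?E1 ?E2; [exact: differentiableB|exact: differentiableD].
rewrite /cderive E1 E2 deriveB; try exact: diff_derivable.
rewrite deriveD; try exact: diff_derivable.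
rewrite !deriveM; try exact: diff_derivable.
rewrite -/fr -/fi -/gr -/gi /GRing.scale /=.
move: ('D_v fr x) ('D_v fi x) ('D_v gr x) ('D_v gi x) => a b c e.
apply/eqP; rewrite eq_complex !ReD !ImD !ReM !ImM /=.
by rewrite -/(fr x) -/(fi x) -/(gr x) -/(gi x); apply/andP; split; apply/eqP; ring.
Qed.

Lemma cderive_sum (I : Type) (r : seq I) (F : I -> V -> R[i]) x v :
  (forall i, cdifferentiable (F i) x) ->
  cdifferentiable (fun y => \sum_(i <- r) F i y) x /\
  cderive (fun y => \sum_(i <- r) F i y) x v = \sum_(i <- r) cderive (F i) x v.
Proof.
move=> dF; elim: r => [|i r [d IH]].
  under eq_fun do rewrite big_nil.
  by rewrite big_nil; split; [exact: cdifferentiable_cst|exact: cderive_cst].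
under eq_fun do rewrite big_cons.
have [d' E] := cderiveD v (dF i) d.
by split=> //; rewrite E IH big_cons.
Qed.

(** The factor of index i is replaced by its derivative; stated with a
    conditional so that, summed over permutations, the terms are determinants
    with one row replaced. *)
Lemma cderive_prod k (F : 'I_k -> V -> R[i]) x v :
  (forall i, cdifferentiable (F i) x) ->
  cdifferentiable (fun y => \prod_(i < k) F i y) x /\
  cderive (fun y => \prod_(i < k) F i y) x v =
  \sum_(i < k) \prod_(j < k) (if j == i then cderive (F j) x v else F j x).
Proof.
elim: k F => [|k IH] F dF.
  under eq_fun do rewrite big_ord0.
  by rewrite big_ord0; split; [exact: cdifferentiable_cst|exact: cderive_cst].
under eq_fun do rewrite big_ord_recl.
have [d E] := IH (fun i => F (lift ord0 i)) (fun i => dF _).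
have [d' E'] := cderiveM v (dF ord0) d.
split=> //; rewrite E' E big_ord_recl; congr (_ + _).
  by rewrite big_ord_recl eqxx.
rewrite mulr_sumr; apply: eq_bigr => i _; rewrite big_ord_recl /=.
by congr (_ * _).
Qed.

(** Jacobi's formula: differentiating the Leibniz expansion replaces one row
    at a time, and expanding along this row produces cofactors. *)
Lemma cderive_det k (M : V -> 'M[R[i]]_k) x v :
  (forall i j, cdifferentiable (fun y => M y i j) x) ->
  cdifferentiable (fun y => \det (M y)) x /\
  cderive (fun y => \det (M y)) x v =
  \tr ((\matrix_(i, j) cderive (fun y => M y i j) x v) *m \adj (M x)).
Proof.
move=> dM; pose dMx := \matrix_(i, j) cderive (fun y => M y i j) x v.
have dP (s : 'S_k) := cderive_prod (F := fun i y => M y i (s i)) v (fun i => dM i (s i)).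
have dS (s : 'S_k) : cdifferentiable (fun y => (-1) ^+ s * \prod_i M y i (s i)) x /\
  cderive (fun y => (-1) ^+ s * \prod_i M y i (s i)) x v =
  (-1) ^+ s * \sum_i \prod_j (if j == i then dMx j (s j) else M x j (s j)).
  have [d E] := cderiveM v (cdifferentiable_cst ((-1) ^+ s) x) (dP s).1.
  split=> //; rewrite E cderive_cst mul0r add0r (dP s).2; congr (_ * _).
  by apply: eq_bigr => i _; apply: eq_bigr => j _; rewrite mxE.
have [d E] := cderive_sum (index_enum 'S_k) v (fun s => (dS s).1).
split=> //; rewrite [LHS]E; under eq_bigr do rewrite (dS _).2 mulr_sumr.
rewrite exchange_big /=; apply: eq_bigr => i _; rewrite mxE.
pose Mi := \matrix_(j, l) (if j == i then dMx j l else M x j l).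
transitivity (\det Mi).
  by apply: eq_bigr => s _; congr (_ * _); apply: eq_bigr => j _; rewrite [RHS]mxE.
rewrite (expand_det_row _ i); apply: eq_bigr => j _; rewrite /adjugate [Mi _ _]mxE eqxx.
rewrite [X in _ = _ * X]mxE; congr (_ * _); rewrite /cofactor; congr (_ * \det _).
apply/matrixP => p q; rewrite !mxE; case: eqP => // /eqP.
by rewrite eq_sym (negPf (neq_lift _ _)).
Qed.

(** After rotation of F by its value at x, the continuous argument theta is
    theta x + atan of a quotient of differentiable functions near x. The
    radius rho may be negative, since only the quotient matters. *)
Lemma cderive_argument (F : V -> R[i]) (theta rho : V -> R) x v (w : R[i]) :
  {for x, continuous theta} ->
  {near x, forall y, rho y != 0 /\
    F y = (rho y * cos (theta y)) +i* (rho y * sin (theta y))} ->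
  cdifferentiable F x -> cderive F x v = F x * w ->
  differentiable theta x /\ 'D_v theta x = complex.Im w.
Proof.
move=> ct FE [dr di] Fw.
pose Fr y := complex.Re (F y); pose Fi y := complex.Im (F y).
pose t0 := theta x.
pose c y := cos t0 * Fr y + sin t0 * Fi y.
pose s y := cos t0 * Fi y - sin t0 * Fr y.
have cE : {near x, forall y, c y = rho y * cos (theta y - t0) /\
    s y = rho y * sin (theta y - t0)}.
  apply: filterS FE => y [_ E]; rewrite /c /s /Fr /Fi E /= cosB sinB.
  by split; ring.
have cosp : {near x, forall y, 0 < cos (theta y - t0) /\
    theta y - t0 \in `](- (pi / 2)), (pi / 2)[%R}.
  have pi20 : 0 < pi / 2 :> R by rewrite divr_gt0// pi_gt0.
  have H : \forall y \near x, `|theta x - theta y| < pi / 2.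
    by move/cvgrPdist_lt : ct; exact.
  apply: filterS H => y.
  rewrite distrC ltr_norml => /andP[h1 h2].
  by split; [apply: cos_gt0_pihalf; rewrite h1|rewrite in_itv /= h1].
have c0 : {near x, forall y, c y != 0}.
  apply: filterS3 FE cE cosp => y [r0 _] [-> _] [h _].
  by rewrite mulf_neq0// gt_eqF.
have tE : {near x, (fun y => t0 + atan (s y / c y)) =1 theta}.
  apply: filterS3 FE cE cosp => y [r0 _] [-> ->] [h hin].
  rewrite -mulf_div divff// mul1r -/(tan _) tanK//.
  by rewrite addrC subrK.
have dc : differentiable c x.
  by apply: differentiableD; exact: differentiableZ.
have ds : differentiable s x.
  by apply: differentiableB; exact: differentiableZ.
have dq : differentiable (s * (fun y => (c y)^-1)) x.
  apply: differentiableM => //; apply: differentiableV => //.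
  exact: nbhs_singleton c0.
have da (t : R) : differentiable (@atan R) t.
  by apply/derivable1_diffP; exact: derivable_atan.
have dtheta : differentiable (fun y => t0 + atan (s y / c y)) x.
  by apply: differentiableD => //; exact: (differentiable_comp dq (da _)).
split; first exact: near_eq_differentiable tE dtheta.
have [r0 Ex] := nbhs_singleton FE.
have [cx sx] := nbhs_singleton cE.
rewrite subrr cos0 mulr1 in cx; rewrite subrr sin0 mulr0 in sx.
have Ds : 'D_v s x = rho x * complex.Im w.
  have -> : 'D_v s x = cos t0 * 'D_v Fi x - sin t0 * 'D_v Fr x.
    rewrite deriveB; [|exact/derivableZ/diff_derivable..].
    by rewrite !deriveZ; try exact: diff_derivable.
  move: Fw => /eqP; rewrite eq_complex ReM ImM Ex /= -/Fr -/Fi.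
  move=> /andP[/eqP -> /eqP ->].
  rewrite -[RHS]mul1r -(cos2Dsin2 t0) /t0; ring.
have q0 : (s * (fun y => (c y)^-1)) x = 0 by rewrite fctE /= sx mul0r.
rewrite -(near_eq_derive _ tE) deriveD; last 2 first.
- exact: diff_derivable.
- by apply: diff_derivable; exact: (differentiable_comp dq (da _)).
rewrite derive_cst add0r deriveE; last exact: (differentiable_comp dq (da _)).
rewrite [X in 'd X _](_ : _ = @atan R \o (s * (fun y => (c y)^-1)))//.
rewrite diff_comp// /= diff1E// q0 derive1_atan expr0n addr0 invr1 -deriveE//.
rewrite [_ *: 1]mulr1 deriveM; [|exact: diff_derivable|]; last first.
  apply: diff_derivable; apply: differentiableV => //; exact: nbhs_singleton c0.
by rewrite sx scale0r add0r cx Ds /GRing.scale /= mulKf.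
Qed.

End Jacobi.

(** * Symmetric sums over roots depend continuously on the coefficients *)

Section RootContinuity.
Context {R : realType}.

Lemma nearest_entry (r : R) (l : seq R) : l != [::] ->
  exists s, s \in l /\ forall q, q \in l -> `|r - s| <= `|r - q|.
Proof.
elim: l => // h [|h' l] IH _.
  by exists h; split=> [|q]; rewrite inE// => /eqP ->.
have [s [sl sm]] := IH isT.
have [rh|rh] := leP `|r - s| `|r - h|.
  exists s; split=> [|q]; first by rewrite inE sl orbT.
  by rewrite inE => /orP[/eqP ->//|]; exact: sm.
exists h; split=> [|q]; first by rewrite inE eqxx.
by rewrite inE => /orP[/eqP ->//|/sm]; exact/le_trans/ltW.
Qed.

(** Each factor of the product is at least the smallest distance. *)
Lemma nearest_root_bound (r s : R) (l : seq R) :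
  (forall q, q \in l -> `|r - s| <= `|r - q|) ->
  `|r - s| ^+ size l <= `|(\prod_(q <- l) ('X - q%:P)).[r]|.
Proof.
elim: l => [|h l IH] sm; first by rewrite big_nil hornerC normr1.
rewrite big_cons hornerM hornerXsubC normrM exprS ler_pM//.
  by apply: sm; rewrite inE eqxx.
by apply: IH => q ql; apply: sm; rewrite inE ql orbT.
Qed.

(** Induction on the degree. At a root r0 of the limit the polynomials tend to
    0, so their root s nearest to r0 tends to r0; the coefficients of the
    quotient by X - s are polynomials in s and the coefficients, hence
    converge too. *)
Lemma cvg_symmetric_sum (T : Type) (F : set_system T) {FF : Filter F} n
    (l : T -> seq R) (l0 : seq R) (phi : R -> R) :
  continuous phi -> (forall t, size (l t) = n) -> size l0 = n ->
  (forall k, (\prod_(r <- l t) ('X - r%:P))`_k @[t --> F] -->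
     (\prod_(r <- l0) ('X - r%:P))`_k) ->
  \sum_(r <- l t) phi r @[t --> F] --> \sum_(r <- l0) phi r.
Proof.
move=> cphi; elim: n l l0 => [|n IH] l l0 sl sl0 cl.
  rewrite (size0nil sl0) big_nil.
  under eq_fun do rewrite (size0nil (sl _)) big_nil.
  exact: cvg_cst.
case: l0 sl0 cl => // r0 l0 [sl0] cl.
have : forall t, exists s, s \in l t /\ forall q, q \in l t -> `|r0 - s| <= `|r0 - q|.
  by move=> t; apply: nearest_entry; rewrite -size_eq0 sl.
move=> /choice[s sP].
pose l' t := rem (s t) (l t).
have sl' t : size (l' t) = n by rewrite size_rem ?sl//; have [] := sP t.
have pl t : perm_eq (l t) (s t :: l' t) by apply: perm_to_rem; have [] := sP t.
pose p t : {poly R} := \prod_(r <- l t) ('X - r%:P).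
pose p' t : {poly R} := \prod_(r <- l' t) ('X - r%:P).
pose p0 : {poly R} := \prod_(r <- r0 :: l0) ('X - r%:P).
pose p0' : {poly R} := \prod_(r <- l0) ('X - r%:P).
have pE t : p t = ('X - (s t)%:P) * p' t.
  by rewrite /p (perm_big _ (pl t)) big_cons.
have p0E : p0 = ('X - r0%:P) * p0' by rewrite /p0 big_cons.
have size_p' t : size (p' t) = n.+1 by rewrite size_prod_XsubC sl'.
have cs : s t @[t --> F] --> r0.
  have cp : (p t).[r0] @[t --> F] --> (0 : R).
    have -> : 0 = \sum_(k < n.+2) p0`_k * r0 ^+ k.
      rewrite -horner_coef_wide; last by rewrite size_prod_XsubC /= sl0.
      by rewrite p0E hornerM hornerXsubC subrr mul0r.
    rewrite (_ : (fun t => _) = fun t => \sum_(k < n.+2) (p t)`_k * r0 ^+ k).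
      apply: cvg_big => [|k _]; first exact: add_continuous.
      by apply: cvgMl; exact: cl.
    apply/funext => t; rewrite -horner_coef_wide//.
    by rewrite size_prod_XsubC sl.
  apply/cvgrPdist_lt => e e0; move/cvgrPdist_lt : cp => /(_ (e ^+ n.+1)).
  rewrite exprn_gt0// => /(_ isT); apply: filterS => t.
  rewrite sub0r normrN => pe.
  have := nearest_root_bound (sP t).2; rewrite sl => le.
  by have := le_lt_trans le pe; rewrite ltr_pXn2r// nnegrE ltW.
have cp' : forall k, (p' t)`_k @[t --> F] --> p0'`_k.
  (* Descending recursion on the coefficients of a quotient by X - a. *)
  have rec (q : {poly R}) (a : R) k : q`_k = (('X - a%:P) * q)`_k.+1 + a * q`_k.+1.
    by rewrite mulrBl coefB coefXM coefCM subrK.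
  have big k : (n < k)%N -> (p' t)`_k @[t --> F] --> p0'`_k.
    move=> nk; rewrite [p0'`_k]nth_default ?size_prod_XsubC ?sl0//.
    under eq_fun do rewrite nth_default ?size_p'//.
    exact: cvg_cst.
  suff H j k : (n < k + j)%N -> (p' t)`_k @[t --> F] --> p0'`_k.
    by move=> k; apply: (H n.+1); rewrite addnS ltnS leq_addl.
  elim: j k => [|j IHj] k; first by rewrite addn0; exact: big.
  rewrite addnS -addSn => /IHj h.
  rewrite (rec p0' r0) -p0E.
  under eq_fun => t do rewrite (rec (p' t) (s t)) -pE.
  by apply: cvgD; [exact: cl|exact: cvgM].
have := IH l' l0 sl' sl0 cp' => IH'.
rewrite big_cons.
under eq_fun do rewrite (perm_big _ (pl _)) big_cons.
apply: cvgD => //; exact: (cvg_comp _ _ cs (cphi r0)).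
Qed.

End RootContinuity.

Section ContinuousCoefficients.
Context {R : realType} {T : topologicalType} (t0 : T).

Definition coef_continuous (p : T -> {poly R}) :=
  forall k, (p t)`_k @[t --> t0] --> (p t0)`_k.

Lemma coef_continuous_cst q : coef_continuous (cst q).
Proof. by move=> k; exact: cvg_cst. Qed.

Lemma coef_continuous_polyC (f : T -> R) : f t @[t --> t0] --> f t0 ->
  coef_continuous (fun t => (f t)%:P).
Proof.
move=> cf [|k]; under eq_fun do rewrite coefC //=; rewrite coefC//=.
exact: cvg_cst.
Qed.

Lemma coef_continuousD p q : coef_continuous p -> coef_continuous q ->
  coef_continuous (fun t => p t + q t).
Proof.
move=> cp cq k; under eq_fun do rewrite coefD; rewrite coefD.
exact: (cvgD (cp k) (cq k)).
Qed.

Lemma coef_continuousM p q : coef_continuous p -> coef_continuous q ->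
  coef_continuous (fun t => p t * q t).
Proof.
move=> cp cq k.
under eq_fun do rewrite coefM; rewrite coefM.
apply: cvg_big => [|j _]; first exact: add_continuous.
exact: (cvgM (cp j) (cq (k - j)%N)).
Qed.

Lemma coef_continuous_sum (I : Type) (r : seq I) (p : I -> T -> {poly R}) :
  (forall i, coef_continuous (p i)) ->
  coef_continuous (fun t => \sum_(i <- r) p i t).
Proof.
move=> cp; elim: r => [|i r IH].
  rewrite (_ : (fun t => _) = cst 0); first exact: coef_continuous_cst.
  by apply/funext => t; rewrite big_nil.
rewrite (_ : (fun t => _) = fun t => p i t + \sum_(j <- r) p j t).
  exact: coef_continuousD.
by apply/funext => t; rewrite big_cons.
Qed.

Lemma coef_continuous_prod (I : Type) (r : seq I) (p : I -> T -> {poly R}) :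
  (forall i, coef_continuous (p i)) ->
  coef_continuous (fun t => \prod_(i <- r) p i t).
Proof.
move=> cp; elim: r => [|i r IH].
  rewrite (_ : (fun t => _) = cst 1); first exact: coef_continuous_cst.
  by apply/funext => t; rewrite big_nil.
rewrite (_ : (fun t => _) = fun t => p i t * \prod_(j <- r) p j t).
  exact: coef_continuousM.
by apply/funext => t; rewrite big_cons.
Qed.

Lemma coef_continuous_det n (A : T -> 'M[{poly R}]_n) :
  (forall i j, coef_continuous (fun t => A t i j)) ->
  coef_continuous (fun t => \det (A t)).
Proof.
move=> cA; apply: coef_continuous_sum => s.
apply: (@coef_continuousM (cst ((-1) ^+ s))); first exact: coef_continuous_cst.
exact: coef_continuous_prod.
Qed.

(** The polynomial p is the characteristic polynomial of h A^-1, obtained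
    without inverting A. *)
Lemma coef_continuous_pencil n (A h : T -> 'M[R]_n) (p : T -> {poly R}) :
  {near t0, forall t, \det (A t) != 0 /\
    \det ('X *: map_mx polyC (A t) - map_mx polyC (h t)) = p t * (\det (A t))%:P} ->
  (forall i j, A t i j @[t --> t0] --> A t0 i j) ->
  (forall i j, h t i j @[t --> t0] --> h t0 i j) ->
  coef_continuous p.
Proof.
move=> Ap cA ch k.
have c1 : \det (A t) @[t --> t0] --> \det (A t0).
  have : coef_continuous (fun t => \det (map_mx polyC (A t))).
    apply: coef_continuous_det => i j.
    rewrite (_ : (fun t => _) = fun t => (A t i j)%:P).
      exact: coef_continuous_polyC.
    by apply/funext => t; rewrite mxE.
  move=> /(_ 0%N); under eq_fun do rewrite det_map_mx coefC eqxx.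
  by rewrite det_map_mx coefC eqxx.
have c2 : coef_continuous (fun t =>
    \det ('X *: map_mx polyC (A t) - map_mx polyC (h t))).
  apply: coef_continuous_det => i j.
  rewrite (_ : (fun t => _) =
      (fun t => 'X * (A t i j)%:P + (- h t i j)%:P)); last first.
    by apply/funext => t; rewrite 5!mxE polyCN.
  apply: coef_continuousD.
    apply: (@coef_continuousM (cst 'X)); first exact: coef_continuous_cst.
    exact: coef_continuous_polyC.
  by apply: coef_continuous_polyC; exact: (cvgN (ch i j)).
have E : {near t0, forall t,
    (\det ('X *: map_mx polyC (A t) - map_mx polyC (h t)))`_k *
    (\det (A t))^-1 = (p t)`_k}.
  by apply: filterS Ap => t [A0 ->]; rewrite coefMC mulfK.
rewrite -(nbhs_singleton E); apply: cvg_trans (near_eq_cvg E) _.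
by apply: cvgM; [exact: c2|apply: cvgV => //; have [] := nbhs_singleton Ap].
Qed.

End ContinuousCoefficients.

(** * The Gauss map in local coordinates *)

Section RealAux.
Context {R : realType}.
Implicit Types p q : R.

Lemma nonneg_sum_eq0 p q : 0 <= p -> 0 <= q -> p + q = 0 -> p = 0.
Proof. by move=> p0 q0 /eqP; rewrite paddr_eq0// => /andP[/eqP]. Qed.

Lemma half_sub_eq0 p q : p = q -> 2^-1 * (p - q) = 0.
Proof. by move=> ->; rewrite subrr mulr0. Qed.

Lemma scaled_entry (k l : R) p q : p = q -> k * (l * p) = k * q * l.
Proof. by move=> ->; ring. Qed.

Lemma double_half (k l : R) : 2 * k * (2^-1 * l) = l * k.
Proof. by field. Qed.

Lemma mx_entry m n (M : 'M[R]_(m, n)) i j :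
  M i j = ((delta_mx 0 i : 'rV_m) *m M *m (delta_mx 0 j : 'rV_n)^T) 0 0.
Proof. by rewrite -rowE trmx_delta -colE !mxE. Qed.

End RealAux.

Section GaussLocal.
Local Opaque derive diff pscal cscal imulr cmulr.
Context {R : realType} {n m : nat}.
Local Notation d := n.+2.
Local Notation B := (@cscal R d 2).
Local Notation J := (@imulr R d).
Local Notation P := (pscal 2).
Variables (N : set 'rV[R]_n) (V : set 'rV[R]_m).
Variables (a b : 'rV[R]_n -> 'rV[R]_d) (f : 'rV[R]_n -> 'rV[R]_m).
Variable (Q : 'rV[R]_m -> 'rV[R]_(d + d)).
Hypotheses (oN : open N) (oV : open V).
Hypothesis Ca : forall y, N y -> twice_differentiable a y.
Hypothesis Cb : forall y, N y -> twice_differentiable b y.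
Hypothesis Cf : forall y, N y -> twice_differentiable f y.
Hypothesis CQ : forall y, V y -> twice_differentiable Q y.
Hypothesis fV : forall y, N y -> V (f y).
Hypothesis QQ : forall y, V y -> B (Q y) (Q y) = -1.
Hypothesis aa : forall y, N y -> P (a y) (a y) = -1.
Hypothesis bb : forall y, N y -> P (b y) (b y) = -1.
Hypothesis ba : forall y, N y -> P (b y) (a y) = 0.
Hypothesis bda : forall y v, N y -> P (b y) ('D_v a y) = 0.

Let zeta y := row_mx (a y) (b y).
Let z y := Q (f y).

Hypothesis same_line : forall y, N y -> exists k l, zeta y = cmulr k l (z y).

Let da y : N y -> differentiable a y.
Proof. by move=> /Ca/twice_differentiable1. Qed.
Let db y : N y -> differentiable b y.
Proof. by move=> /Cb/twice_differentiable1. Qed.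
Let df y : N y -> differentiable f y.
Proof. by move=> /Cf/twice_differentiable1. Qed.

Let Cz y : N y -> twice_differentiable z y.
Proof.
by move=> Ny; exact: (twice_differentiable_comp (Cf Ny) (CQ (fV Ny))).1.
Qed.
Let dz y : N y -> differentiable z y.
Proof. by move=> /Cz/twice_differentiable1. Qed.
Let dzeta y : N y -> differentiable zeta y.
Proof. by move=> Ny; exact: (derive_row_mx 0 (da Ny) (db Ny)).1. Qed.

Lemma derive_const_on (F : 'rV[R]_n -> R) (k : R) :
  (forall y, N y -> F y = k) -> forall y v, N y -> 'D_v F y = 0.
Proof.
move=> Fk y v Ny.
by rewrite (@derive_eq_on_open _ _ _ N F (cst (k : R^o)) oN)// derive_cst.
Qed.

Lemma normal_relations y v : N y ->
  [/\ P ('D_v a y) (a y) = 0, P ('D_v b y) (b y) = 0 & P ('D_v b y) (a y) = 0].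
Proof.
move=> Ny; split.
- have := derive_const_on aa v Ny.
  by rewrite (derive_pscal _ _ (da Ny) (da Ny)) [P (a y) _]pscal_sym; lra.
- have := derive_const_on bb v Ny.
  by rewrite (derive_pscal _ _ (db Ny) (db Ny)) [P (b y) _]pscal_sym; lra.
- have := derive_const_on ba v Ny.
  by rewrite (derive_pscal _ _ (db Ny) (da Ny)) bda// addr0.
Qed.

(* zeta y = (c1 y + i c2 y) z y; the signs come from the norm -1 of z *)
Let c1 y := - B (zeta y) (z y).
Let c2 y := - B (zeta y) (J (z y)).

Let zz y : N y -> B (z y) (z y) = -1.
Proof. by move=> /fV/QQ. Qed.

(** Pairing with z and J z recovers the factor, which is therefore as regular
    as zeta and z. *)
Lemma zetaE y : N y -> zeta y = cmulr (c1 y) (c2 y) (z y).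
Proof.
move=> Ny; have [k [l E]] := same_line Ny.
rewrite /c1 /c2 E; have [-> ->] := cscal_cmulr_unit k l (zz Ny).
by rewrite !opprK.
Qed.

Lemma phase_norm y : N y -> c1 y ^+ 2 + c2 y ^+ 2 = 2.
Proof.
move=> Ny; have : B (zeta y) (zeta y) = -2.
  by rewrite cscal_row_mx aa// bb//; ring.
rewrite {1 2}(zetaE Ny) cscal_cmulr zz//; lra.
Qed.

Lemma derive_zeta y v : N y -> 'D_v zeta y = row_mx ('D_v a y) ('D_v b y).
Proof. by move=> Ny; exact: (derive_row_mx v (da Ny) (db Ny)).2. Qed.

(** Uses both that b is tangent to anti-de Sitter space and that it is normal
    to the immersion. *)
Lemma derive_zeta_orth y v : N y ->
  B ('D_v zeta y) (zeta y) = 0 /\ B ('D_v zeta y) (J (zeta y)) = 0.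
Proof.
move=> Ny; rewrite derive_zeta// /zeta imulr_row_mx !cscal_row_mx pscalNr.
have [-> -> ->] := normal_relations v Ny.
by rewrite [P _ (b y)]pscal_sym bda//; split; ring.
Qed.

Lemma derive_zeta_orth_z y v : N y ->
  B ('D_v zeta y) (z y) = 0 /\ B ('D_v zeta y) (J (z y)) = 0.
Proof.
move=> Ny; have [] := derive_zeta_orth v Ny; rewrite {1 2}(zetaE Ny).
exact: cmulr_orth (phase_norm Ny).
Qed.

(* X v y is the horizontal lift of dG(v); theta is its vertical correction. *)
Let theta v y := B ('D_v z y) (J (z y)).
Let X v y := 'D_v z y + theta v y *: J (z y).

Lemma derive_z_orth y v : N y -> B ('D_v z y) (z y) = 0.
Proof.
move=> Ny; have := derive_const_on zz v Ny.
by rewrite (derive_cscal _ _ (dz Ny) (dz Ny)) [B (z y) _]cscal_sym; lra.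
Qed.

Let dJz y : N y -> differentiable (fun y => J (z y)) y.
Proof. by move=> Ny; apply: differentiable_linear_comp; exact: dz. Qed.

Let dc1 y : N y -> differentiable c1 y.
Proof.
by move=> Ny; apply: differentiableN; apply: differentiable_cscal; [exact: dzeta|exact: dz].
Qed.

Let dc2 y : N y -> differentiable c2 y.
Proof.
by move=> Ny; apply: differentiableN; apply: differentiable_cscal; [exact: dzeta|exact: dJz].
Qed.

(** Horizontality of the derivatives of zeta imposes how fast the phase turns.
    *)
Lemma derive_phase y v : N y ->
  'D_v c1 y = - c2 y * theta v y /\ 'D_v c2 y = c1 y * theta v y.
Proof.
move=> Ny; have [h1 h2] := derive_zeta_orth_z v Ny.
have d1 : differentiable (fun y => B (zeta y) (z y)) y.
  by apply: differentiable_cscal; [exact: dzeta|exact: dz].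
have d2 : differentiable (fun y => B (zeta y) (J (z y))) y.
  by apply: differentiable_cscal; [exact: dzeta|exact: dJz].
have h3 := derive_z_orth v Ny.
split; rewrite deriveN; try exact: diff_derivable.
  rewrite (derive_cscal _ _ (dzeta Ny) (dz Ny)) h1 add0r (zetaE Ny) cscal_sym.
  rewrite cmulrE cscalDr !cscalZr h3 /theta; ring.
rewrite (derive_cscal _ _ (dzeta Ny) (dJz Ny)) h2 add0r.
rewrite (derive_linear_comp _ _ (dz Ny)).
rewrite (zetaE Ny) cmulrE cscalDl !cscalZl cscalJ [B (z y) ('D_v z y)]cscal_sym h3.
by rewrite [B (z y) _]cscal_sym cscalJl /theta; ring.
Qed.

Lemma derive_zetaE y v : N y -> 'D_v zeta y = cmulr (c1 y) (c2 y) (X v y).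
Proof.
move=> Ny; have d1 : differentiable (fun y => c1 y *: z y) y.
  by apply: differentiable_scale; [exact: dc1|exact: dz].
have d2 : differentiable (fun y => c2 y *: J (z y)) y.
  by apply: differentiable_scale; [exact: dc2|exact: dJz].
have -> : 'D_v zeta y = 'D_v (fun y => c1 y *: z y + c2 y *: J (z y)) y.
  by apply: (derive_eq_on_open oN) => // y' Ny'; exact: zetaE.
rewrite deriveD; try exact: diff_derivable.
rewrite (derive_scale _ (dc1 Ny) (dz Ny)) (derive_scale _ (dc2 Ny) (dJz Ny)).
have [-> ->] := derive_phase v Ny.
rewrite (derive_linear_comp _ _ (dz Ny)); exact: cmulr_leibniz.
Qed.

(** The argument of cmulr is the vector through which
    hopf_lift_covariant_derivative expresses the connection; the remaining
    terms are vertical. *)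
Lemma derive2_zetaE y u v : N y -> exists r r',
  'D_u ('D_v zeta) y = cmulr (c1 y) (c2 y)
    ('D_u ('D_v z) y + theta v y *: J ('D_u z y) + theta u y *: J ('D_v z y))
  + r *: z y + r' *: J (z y).
Proof.
move=> Ny; have [_ d2z] := Cz Ny.
have dth : differentiable (theta v) y.
  by apply: differentiable_cscal => //; exact: dJz.
have dtJ : differentiable (fun y => theta v y *: J (z y)) y.
  by apply: differentiable_scale => //; exact: dJz.
have dX : differentiable (X v) y by apply: differentiableD.
have dJX : differentiable (fun y => J (X v y)) y.
  exact: differentiable_linear_comp.
have d1 : differentiable (fun y => c1 y *: X v y) y.
  by apply: differentiable_scale => //; exact: dc1.
have d2 : differentiable (fun y => c2 y *: J (X v y)) y.
  by apply: differentiable_scale => //; exact: dc2.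
have -> : 'D_u ('D_v zeta) y = 'D_u (fun y => c1 y *: X v y + c2 y *: J (X v y)) y.
  by apply: (derive_eq_on_open oN) => // y' Ny'; exact: derive_zetaE.
rewrite deriveD; try exact: diff_derivable.
rewrite (derive_scale _ (dc1 Ny) dX) (derive_scale _ (dc2 Ny) dJX).
have [-> ->] := derive_phase u Ny.
rewrite derive_linear_comp//.
have -> : 'D_u (X v) y =
    'D_u ('D_v z) y + ('D_u (theta v) y *: J (z y) + theta v y *: J ('D_u z y)).
  rewrite deriveD; try exact: diff_derivable.
  by rewrite (derive_scale _ dth (dJz Ny)) (derive_linear_comp _ _ (dz Ny)).
eexists; eexists; exact: cmulr_leibniz2.
Qed.

Hypothesis Qn : forall y, V y ->
  rscal 2 (Q y) (Q y) = 0 /\ rscal 2 (Q y) (J (Q y)) = 0.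
Hypothesis nm : (n + n <= m)%N.
Variable x : 'rV[R]_n.
Hypothesis Nx : N x.
Hypothesis a_pos : forall v, v != 0 -> 0 < P ('D_v a x) ('D_v a x).
Hypothesis hl_inj : forall w, hopf_lift 2 Q (f x) w = 0 -> w = 0.
Local Notation hl := (hopf_lift 2 Q (f x)).
Local Notation ph := (cmulr (c1 x) (c2 x)).

Let nearV : {near f x, forall y, V y}.
Proof. exact: open_nbhs_nbhs (conj oV (fV Nx)). Qed.
Let nearQQ : {near f x, forall y, B (Q y) (Q y) = -1}.
Proof. by apply: filterS nearV => y /QQ. Qed.
Let CQx : twice_differentiable Q (f x). Proof. exact/CQ/fV. Qed.
Let dQ : differentiable Q (f x). Proof. exact: twice_differentiable1. Qed.

Lemma hopf_lift_gauss v : hl ('D_v f x) = X v x.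
Proof.
have E : 'd Q (f x) ('D_v f x) = 'D_v z x.
  exact (esym (derive_comp v (df Nx) dQ)).
rewrite /hopf_lift E (derive_z_orth v Nx) scale0r addr0.
by [].
Qed.

Lemma phase_hopf_lift_gauss v :
  ph (hl ('D_v f x)) = row_mx ('D_v a x) ('D_v b x).
Proof. by rewrite hopf_lift_gauss -derive_zeta// derive_zetaE. Qed.

Let phase_norm_x : c1 x ^+ 2 + c2 x ^+ 2 = 2. Proof. exact: phase_norm. Qed.

Lemma derive_a_eq0 v : 'D_v a x = 0 -> v = 0.
Proof.
move=> av; apply/eqP/negPn/negP => /a_pos.
by rewrite av pscal0l ltxx.
Qed.

(** The tangent space of the immersion has the dimension of the orthogonal
    complement of a and b. *)
Lemma tangent_space w : P (a x) w = 0 -> P (b x) w = 0 ->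
  exists v, w = 'D_v a x.
Proof.
move=> aw bw; have [] := @orthogonal_complement R n (jacobian a x) (a x) (b x) w.
- apply: inj_row_free => v; rewrite -deriveEjacobian; last exact: da.
  exact: derive_a_eq0.
- exact: aa.
- exact: bb.
- exact: ba.
- move=> v; rewrite -deriveEjacobian; last exact: da.
  by rewrite pscal_sym; have [] := normal_relations v Nx.
- by move=> v; rewrite -deriveEjacobian; [exact: bda|exact: da].
- by [].
- by [].
by move=> v ->; exists v; rewrite deriveEjacobian//; exact: da.
Qed.

Lemma weingarten v : exists w, 'D_v b x = 'D_w a x.
Proof.
have [_ h1 h2] := normal_relations v Nx.
by apply: tangent_space; rewrite pscal_sym.
Qed.

(** Differentiate the orthogonality of b and the tangent vectors, and use the
    symmetry of second derivatives. *)
Lemma second_form_sym y u v : N y ->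
  P ('D_u b y) ('D_v a y) = P ('D_v b y) ('D_u a y).
Proof.
move=> Ny; have H u' v' : P ('D_u' b y) ('D_v' a y) = - P (b y) ('D_u' ('D_v' a) y).
  have := derive_const_on (fun y => bda v' (y := y)) u' Ny.
  by rewrite (derive_pscal _ _ (db Ny) ((Ca Ny).2 v')) => /eqP; rewrite addr_eq0 => /eqP.
by rewrite H (derive_comm v u (Ca Ny)) -H.
Qed.

Lemma rscal_hopf_lift w : rscal 2 (hl w) (z x) = 0 /\ rscal 2 (hl w) (J (z x)) = 0.
Proof.
have E1 : 'D_w (fun y => rscal 2 (Q y) (Q y)) (f x) = 0.
  rewrite (@derive_eq_on_open _ _ _ V _ (cst (0 : R^o)) oV) ?derive_cst//.
    by move=> y /Qn[].
  exact: fV.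
have E2 : 'D_w (fun y => rscal 2 (Q y) (J (Q y))) (f x) = 0.
  rewrite (@derive_eq_on_open _ _ _ V _ (cst (0 : R^o)) oV) ?derive_cst//.
    by move=> y /Qn[].
  exact: fV.
have dJQ : differentiable (fun y => J (Q y)) (f x).
  exact: differentiable_linear_comp.
move: E1 E2; rewrite (derive_rscal _ _ dQ dQ) (derive_rscal _ _ dQ dJQ).
rewrite derive_linear_comp// -[rscal _ (Q _) (J ('D_w _ _))]rscalJ.
rewrite [rscal _ (Q _) ('D_w _ _)]rscal_sym [rscal _ (J (Q _)) _]rscal_sym => E1 E2.
have [q1 q2] := Qn (fV Nx).
rewrite (nbhs_singleton (hopf_liftE CQx nearQQ w)).
rewrite !rscalDl !rscalZl rscalJJ rscalJ /z q1 q2.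
by split; lra.
Qed.

(** Rotated by the phase, horizontality and the equation of the quadric say
    that the real and imaginary parts are orthogonal to a and b, hence tangent
    to the immersion. *)
Lemma phase_hopf_lift w : exists u v, ph (hl w) = row_mx ('D_u a x) ('D_v a x).
Proof.
have [h1 h2] := hopf_lift_orth CQx nearQQ w.
have [h3 h4] := rscal_hopf_lift w.
have := @orthogonal_components R _ 2 (lsubmx (ph (hl w))) (rsubmx (ph (hl w))) (a x) (b x).
rewrite /= hsubmxK -/(zeta x) (zetaE Nx) cmulrJ !cscal_cmulr h1 h2 !mulr0.
rewrite !rscal_cmulr_eq0//; last by rewrite imulrK rscalNr h3 oppr0.
move=> /(_ erefl erefl erefl erefl)[p1 p2 p3 p4].
have [u Eu] := tangent_space p1 p2; have [v Ev] := tangent_space p3 p4.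
by exists u, v; rewrite -Eu -Ev hsubmxK.
Qed.

(** Rotated by the phase, horizontal lifts are of the form da(u) + i da(v),
    and the form is positive definite on these. *)
Lemma hopf_metric_unit : hopf_metric 2 Q (f x) \in unitmx.
Proof.
apply: anisotropic_unitmx => w; have [u [v E]] := phase_hopf_lift w.
move=> /matrixP/(_ 0 0); rewrite -hopf_metricE [RHS]mxE => ww.
have : B (ph (hl w)) (ph (hl w)) = 0 by rewrite cscal_cmulr ww mulr0.
have pos0 t : 0 <= P ('D_t a x) ('D_t a x).
  have [->|/a_pos/ltW//] := eqVneq t 0.
  by rewrite derive0 pscal0l.
have eq0 t : P ('D_t a x) ('D_t a x) = 0 -> 'D_t a x = 0.
  have [->|/a_pos + e] := eqVneq t 0; first by rewrite derive0.
  by rewrite e ltxx.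
rewrite E cscal_row_mx => /eqP; rewrite paddr_eq0// => /andP[/eqP/eq0 Eu /eqP/eq0 Ev].
apply: hl_inj; apply: (@cmulr_inj _ _ (c1 x) (c2 x)); first by rewrite phase_norm_x.
by rewrite E Eu Ev row_mx0 linear0.
Qed.

(** The rotated horizontal lifts fill the space of all da(u) + i da(v) by
    equality of dimensions, and this space is stable under multiplication by
    i. *)
Lemma hopf_lift_span v : exists w, hl w = J (hl ('D_v f x)).
Proof.
pose H := lin1_mx (ph \o hl).
(* the row space of T is the space of all da(u) + i da(w) *)
pose T := block_mx (jacobian a x) 0 0 (jacobian a x).
have TE u w : row_mx u w *m T = row_mx ('D_u a x) ('D_w a x).
  rewrite mul_row_block !mulmx0 addr0 add0r.
  by rewrite -!deriveEjacobian//; exact: da.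
have HE w : w *m H = ph (hl w) by rewrite mul_rV_lin1.
have HT : (H <= T)%MS.
  apply/row_subP => i; rewrite rowE HE; have [u [w ->]] := phase_hopf_lift (delta_mx 0 i).
  by rewrite -TE submxMl.
have fH : row_free H.
  apply: inj_row_free => w; rewrite HE => Hw; apply: hl_inj.
  apply: (@cmulr_inj _ _ (c1 x) (c2 x)); first by rewrite phase_norm_x.
  by rewrite Hw linear0.
have /leqifP := mxrank_leqif_sup HT; case: ifP => [TH _|_]; last first.
  rewrite (eqP fH) => mT.
  by have := leq_trans mT (leq_trans (rank_leq_row T) nm); rewrite ltnn.
have [u Eu] := weingarten v.
have : (J (ph (hl ('D_v f x))) <= H)%MS.
  apply: submx_trans TH; rewrite phase_hopf_lift_gauss imulr_row_mx Eu.
  rewrite (_ : - _ = 'D_(- u) a x); last first.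
    by rewrite !deriveE ?linearN//; exact: da.
  by rewrite -TE submxMl.
move=> /submxP[w]; rewrite HE => E; exists w.
by apply: (@cmulr_inj _ _ (c1 x) (c2 x)); rewrite ?phase_norm_x// -cmulrJ.
Qed.

Lemma gauss_metric u v : B (hl ('D_u f x)) (hl ('D_v f x)) =
  2^-1 * (P ('D_u a x) ('D_v a x) + P ('D_u b x) ('D_v b x)).
Proof.
exact (cscal_from_phase 2 phase_norm_x (phase_hopf_lift_gauss v)
  (phase_hopf_lift_gauss u)).
Qed.

(** Lagrangian character of the Gauss map, from the symmetry of the second
    fundamental form. *)
Lemma gauss_lagrangian u v : B (J (hl ('D_u f x))) (hl ('D_v f x)) = 0.
Proof.
apply: etrans (cscalJ_from_phase 2 phase_norm_x (phase_hopf_lift_gauss v)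
  (phase_hopf_lift_gauss u)) _.
exact (half_sub_eq0 (etrans (pscal_sym _ _ _) (second_form_sym v u Nx))).
Qed.

Lemma derive2_zeta u v :
  'D_u ('D_v zeta) x = row_mx ('D_u ('D_v a) x) ('D_u ('D_v b) x).
Proof.
have [_ d2a] := Ca Nx; have [_ d2b] := Cb Nx.
rewrite (derive_eq_on_open oN (fun y => derive_zeta v (y := y)))//.
exact: (derive_row_mx u (d2a v) (d2b v)).2.
Qed.

(** Pairing with J dG(v), which is tangent to the quadric, the covariant
    derivative is replaced by the second derivative of zeta; the phase
    contributes its squared modulus 2. *)
Lemma gauss_covariant_derivative i j v :
  B (J (hl (covariant_derivative (hopf_metric 2 Q) f x i j))) (hl ('D_v f x)) =
  2^-1 * (P (partial i (partial j a) x) ('D_v b x)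
          - P (partial i (partial j b) x) ('D_v a x)).
Proof.
have [w Ew] := hopf_lift_span v; rewrite cscalJl -Ew.
rewrite (hopf_lift_covariant_derivative (Cf Nx) CQx nearQQ hopf_metric_unit).
have [r [r' Eij]] := derive2_zetaE (delta_mx 0 i) (delta_mx 0 j) Nx.
have [h1 h2] := derive_zeta_orth_z v Nx.
rewrite derive2_zeta in Eij; rewrite derive_zeta// in h1, h2; rewrite Ew.
rewrite (cscalJ_from_phase_mod phase_norm_x (phase_hopf_lift_gauss v) Eij h1 h2) opprK.
by [].
Qed.

Variable S : 'M[R]_n.
Hypothesis shapeS : forall v, 'D_v b x = - 'D_(v *m S) a x.
Local Notation e_ i := (delta_mx 0 i : 'rV[R]_n).

Definition first_form y : 'M[R]_n := \matrix_(i, j) P (partial i a y) (partial j a y).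
Definition second_form y : 'M[R]_n := \matrix_(i, j) - P (partial i b y) (partial j a y).

Lemma derive_a_sum w : 'D_w a x = \sum_k w 0 k *: 'D_(e_ k) a x.
Proof. by rewrite deriveE ?diff_partial//; exact: da. Qed.

Lemma shape_row i : 'D_(e_ i) b x = - \sum_k S i k *: 'D_(e_ k) a x.
Proof.
rewrite shapeS derive_a_sum; congr (- _); apply: eq_bigr => k _.
by rewrite -rowE mxE.
Qed.

Lemma second_formE : second_form x = S *m first_form x.
Proof.
apply/matrixP => i j; rewrite !mxE [partial i b x]shape_row pscalNl opprK pscal_suml.
by apply: eq_bigr => k _; rewrite pscalZl mxE.
Qed.

Lemma third_form : \matrix_(i, j) P ('D_(e_ i) b x) ('D_(e_ j) b x) =
  S *m first_form x *m S^T.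
Proof.
rewrite -second_formE; apply/matrixP => i j; rewrite !mxE (shape_row j) pscalNr.
rewrite pscal_sym pscal_suml -sumrN; apply: eq_bigr => k _.
by rewrite !mxE pscalZl pscal_sym mulNr mulrC.
Qed.

Lemma first_form_sym y : (first_form y)^T = first_form y.
Proof.
by apply/matrixP => i j; rewrite [LHS]mxE [LHS]mxE [RHS]mxE; exact (pscal_sym _ _ _).
Qed.

Lemma second_form_trmx y : N y -> (second_form y)^T = second_form y.
Proof.
move=> Ny; apply/matrixP => i j; rewrite [LHS]mxE [LHS]mxE [RHS]mxE.
exact (congr1 -%R (second_form_sym _ _ Ny)).
Qed.

Lemma first_form_quad u v : P ('D_u a x) ('D_v a x) = (u *m first_form x *m v^T) 0 0.
Proof.
rewrite !derive_a_sum pscal_suml mxE.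
under [RHS]eq_bigr => j _ do rewrite mxE mulr_suml.
rewrite [RHS]exchange_big; apply: eq_bigr => i _ /=.
rewrite pscalZl pscal_sym pscal_suml mulr_sumr; apply: eq_bigr => j _.
rewrite pscalZl [first_form _ _ _]mxE [v^T _ _]mxE.
exact (scaled_entry _ _ (pscal_sym _ _ _)).
Qed.

(* twice the metric induced by the Gauss map *)
Let metric2 := first_form x + S *m first_form x *m S^T.

Lemma metric2_unit : metric2 \in unitmx.
Proof.
apply: anisotropic_unitmx => v /matrixP/(_ 0 0); rewrite [RHS]mxE.
rewrite mulmxDr mulmxDl mxE -first_form_quad !mulmxA -(mulmxA _ S^T) -trmx_mul.
rewrite -first_form_quad => v0.
have pos0 t : 0 <= P ('D_t a x) ('D_t a x).
  have [->|/a_pos/ltW//] := eqVneq t 0.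
  by rewrite derive0 pscal0l.
have av := nonneg_sum_eq0 (pos0 _) (pos0 _) v0.
by apply/eqP/negPn/negP => /a_pos; rewrite av ltxx.
Qed.

Lemma first_form_det : \det (first_form x) != 0.
Proof.
rewrite -unitfE -/(_ \in unitmx); apply: anisotropic_unitmx => v /matrixP/(_ 0 0).
rewrite -first_form_quad [RHS]mxE => v0.
by apply/eqP/negPn/negP => /a_pos; rewrite v0 ltxx.
Qed.

Lemma induced_metric_gauss :
  induced_metric (hopf_metric 2 Q) f x = 2^-1 *: metric2.
Proof.
apply/matrixP => i j; rewrite /metric2 -third_form.
have -> : induced_metric (hopf_metric 2 Q) f x i j =
    B (hl ('D_(e_ i) f x)) (hl ('D_(e_ j) f x)).
  rewrite hopf_metricE /induced_metric !deriveEjacobian; try exact: df.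
  by rewrite [LHS]mx_entry /induced_metric trmx_mul !mulmxA.
by rewrite gauss_metric !mxE.
Qed.

Let codazzi_cancel (p1 p1' p2 p2' p3 p4 p4' p5 : R) :
  p1' = p1 -> p2' = p2 -> p4' = p4 ->
  p1' + p2 = p3 + p4' -> p2' - p3 = - (p1 + p5) - - p5 - - p4.
Proof. by lra. Qed.

(** By symmetry of the second fundamental form on a neighborhood, the
    left-hand side is symmetric in j and v; this converts the derivative in
    the direction e_i into one in the direction v. The matrix G corrects for
    the derivative of the tangent frame. *)
Lemma codazzi v i j :
  let G := \matrix_(i, k) P ('D_v (partial i a) x) (partial k a x) in
  let dh := \matrix_(i, j) 'D_v (fun y => second_form y i j) x in
  P (partial i (partial j a) x) ('D_v b x)
    - P (partial i (partial j b) x) ('D_v a x) =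
  (dh - S *m G^T - G *m S^T) i j.
Proof.
move=> G dh; have [_ d2a] := Ca Nx; have [_ d2b] := Cb Nx.
have SG k l : (S *m G^T) k l = - P ('D_(e_ k) b x) ('D_v (partial l a) x).
  rewrite (shape_row k) pscalNl opprK pscal_suml mxE; apply: eq_bigr => m' _.
  by rewrite !mxE pscalZl pscal_sym.
have -> : (dh - S *m G^T - G *m S^T) i j = dh i j - (S *m G^T) i j - (S *m G^T) j i.
  by rewrite 4!mxE -[G *m S^T]trmxK trmx_mul trmxK [X in _ - X]mxE 2![in LHS]mxE.
rewrite !SG.
have dhE : dh i j = - (P ('D_v ('D_(e_ i) b) x) ('D_(e_ j) a x)
    + P ('D_(e_ i) b x) ('D_v (partial j a) x)).
  rewrite mxE; have -> : (fun y => second_form y i j) =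
      - (fun y => P ('D_(e_ i) b y) ('D_(e_ j) a y)).
    by apply/funext => y; rewrite mxE.
  rewrite deriveN; last exact/diff_derivable/differentiable_pscal.
  exact (congr1 -%R (derive_pscal _ _ (d2b _) (d2a _))).
have E : P ('D_(e_ i) ('D_v b) x) ('D_(e_ j) a x)
    + P ('D_v b x) ('D_(e_ i) ('D_(e_ j) a) x) =
    P ('D_(e_ i) ('D_(e_ j) b) x) ('D_v a x)
    + P ('D_(e_ j) b x) ('D_(e_ i) ('D_v a) x).
  exact (etrans (esym (derive_pscal _ _ (d2b v) (d2a (e_ j))))
    (etrans (derive_eq_on_open oN
       (fun y Ny => second_form_sym v (e_ j) Ny) (e_ i) Nx)
    (derive_pscal _ _ (d2b (e_ j)) (d2a v)))).
rewrite dhE.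
exact (codazzi_cancel _ (congr1 (fun w => P w _) (derive_comm v (e_ i) (Cb Nx)))
  (pscal_sym _ _ _) (congr1 (P _) (derive_comm v (e_ i) (Ca Nx))) E).
Qed.

(** The inverse of the metric induced by G is twice the inverse of metric2,
    which compensates the factor 1/2 of gauss_covariant_derivative. The
    tangential parts disappear since G is Lagrangian. *)
Lemma gauss_mean_curvature_form v :
  let G := \matrix_(i, k) P ('D_v (partial i a) x) (partial k a x) in
  let dh := \matrix_(i, j) 'D_v (fun y => second_form y i j) x in
  B (J (hl (mean_curvature (hopf_metric 2 Q) f x))) (hl ('D_v f x)) =
  n%:R^-1 * \tr (invmx metric2 *m (dh - S *m G^T - G *m S^T)).
Proof.
move=> G dh; rewrite /mean_curvature !linearZ /= cscalZl; congr (_ * _).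
rewrite mxtrace_mulC !linear_sum cscal_suml; apply: eq_bigr => i _.
rewrite !linear_sum cscal_suml mxE; apply: eq_bigr => j _ /=.
rewrite !linearZ /= cscalZl induced_metric_gauss.
rewrite invmxZ; last by rewrite unitmxZ ?metric2_unit// unitfE invr_eq0 pnatr_eq0.
rewrite mxE invrK.
rewrite /second_fundamental_form !linearB /= cscalDl cscalNl.
have -> : B (J (hl (tangential_part (hopf_metric 2 Q) f x
    (covariant_derivative (hopf_metric 2 Q) f x i j)))) (hl ('D_v f x)) = 0.
  by rewrite /tangential_part -deriveEjacobian ?gauss_lagrangian//; exact: df.
rewrite subr0 gauss_covariant_derivative codazzi -/G -/dh.
rewrite (_ : invmx metric2 j i = invmx metric2 i j); first exact: double_half.
have Ks : (invmx metric2)^T = invmx metric2.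
  by rewrite trmx_inv /metric2 linearD /= !trmx_mul trmxK first_form_sym mulmxA.
by rewrite -[in LHS]Ks mxE.
Qed.


Lemma derive_first_form v :
  let G := \matrix_(i, k) P ('D_v (partial i a) x) (partial k a x) in
  forall i j, differentiable (fun y => first_form y i j) x /\
    'D_v (fun y => first_form y i j) x = (G + G^T) i j.
Proof.
move=> G i j; have [_ d2a] := Ca Nx.
have -> : (fun y => first_form y i j) =
    (fun y => P ('D_(e_ i) a y) ('D_(e_ j) a y)).
  by apply/funext => y; rewrite mxE.
split; first exact: differentiable_pscal.
rewrite mxE [G i j]mxE [G^T i j]mxE [G j i]mxE.
apply: etrans (derive_pscal _ _ (d2a _) (d2a _)) _.
exact (congr1 (+%R _) (pscal_sym _ _ _)).
Qed.

Lemma differentiable_second_form i j :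
  differentiable (fun y => second_form y i j) x.
Proof.
have [_ d2a] := Ca Nx; have [_ d2b] := Cb Nx.
have -> : (fun y => second_form y i j) =
    - (fun y => P ('D_(e_ i) b y) ('D_(e_ j) a y)).
  by apply/funext => y; rewrite mxE.
by apply: differentiableN; exact: differentiable_pscal.
Qed.

(** Up to the sign of real factors, a continuous argument alpha of F is an
    argument of det (A + i h), whose logarithmic derivative has the trace of
    gauss_mean_curvature_form as imaginary part. *)
Lemma gauss_angle (alpha rho : 'rV[R]_n -> R) (F : 'rV[R]_n -> R[i]) :
  (forall y, N y -> \det (first_form y) != 0 /\
    \det (cplx_mx (first_form y) (second_form y)) =
    (\det (first_form y))%:C * F y) ->
  {for x, continuous alpha} ->
  {near x, forall y, rho y != 0 /\
    F y = (rho y * cos (alpha y)) +i* (rho y * sin (alpha y))} ->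
  differentiable alpha x /\
  forall v, B (J (hl (mean_curvature (hopf_metric 2 Q) f x))) (hl ('D_v f x)) =
    n%:R^-1 * 'D_v alpha x.
Proof.
move=> detF calpha Frho.
pose M y := cplx_mx (first_form y) (second_form y).
have near_rho : {near x, forall y, \det (first_form y) * rho y != 0 /\
    \det (M y) = (\det (first_form y) * rho y * cos (alpha y)) +i*
                 (\det (first_form y) * rho y * sin (alpha y))}.
  have nN : {near x, forall y, N y} := open_nbhs_nbhs (conj oN Nx).
  apply: filterS2 nN Frho => y Ny [r0 FE]; have [A0 ME] := detF _ Ny.
  split; first by rewrite mulf_neq0.
  by rewrite /M ME FE; apply/eqP; rewrite eq_complex /=;
    apply/andP; split; apply/eqP; ring.
have step v : differentiable alpha x /\
    B (J (hl (mean_curvature (hopf_metric 2 Q) f x))) (hl ('D_v f x)) =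
    n%:R^-1 * 'D_v alpha x.
  pose G := \matrix_(i, k) P ('D_v (partial i a) x) (partial k a x).
  pose dh := \matrix_(i, j) 'D_v (fun y => second_form y i j) x.
  have cM i j : cdifferentiable (fun y => M y i j) x /\
      cderive (fun y => M y i j) x v = cplx_mx (G + G^T) dh i j.
    have [dA EA] := derive_first_form v i j.
    have ER : (fun y => complex.Re (M y i j)) = (fun y => first_form y i j).
      by apply/funext => y; rewrite mxE.
    have EI : (fun y => complex.Im (M y i j)) = (fun y => second_form y i j).
      by apply/funext => y; rewrite mxE.
    split; first by split; rewrite ?ER ?EI//; exact: differentiable_second_form.
    by rewrite /cderive ER EI EA [RHS]mxE [dh i j]mxE.
  have [dd dE] := cderive_det v (fun i j => (cM i j).1).
  have [W [MW ImW]] : exists W : 'M[R[i]]_n, M x *m W = 1%:M /\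
      complex.Im (\tr (W *m cplx_mx (G + G^T) dh)) =
      \tr (invmx metric2 *m (dh - S *m G^T - G *m S^T)).
    rewrite /M second_formE; apply: trace_identity.
    - exact: first_form_sym.
    - by rewrite -second_formE; exact: second_form_trmx.
    - exact: metric2_unit.
  have dE' : cderive (fun y => \det (M y)) x v =
      \det (M x) * \tr (W *m cplx_mx (G + G^T) dh).
    rewrite dE (_ : \matrix_(i, j) _ = cplx_mx (G + G^T) dh); last first.
      by apply/matrixP => i j; rewrite mxE (cM i j).2.
    (* W is the inverse of M x *)
    have -> : \adj (M x) = \det (M x) *: W.
      by rewrite -[LHS]mulmx1 -MW mulmxA mul_adj_mx mul_scalar_mx.
    by rewrite -scalemxAr mxtraceZ mxtrace_mulC.
  have [dt ->] := cderive_argument calpha near_rho dd dE'.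
  by rewrite ImW gauss_mean_curvature_form.
by split=> [|v]; [exact: (step 0).1|exact: (step v).2].
Qed.

End GaussLocal.

(** * Charts of the complex hyperbolic quadric *)

Section QuadricChart.
Local Opaque derive diff.
Context {R : realType} {n : nat}.
Local Notation d := n.+2.
Local Notation B := (@cscal R d 2).
Local Notation J := (@imulr R d).

Lemma toC_cmulr (k l : R) (u : 'rV[R]_(d + d)) :
  toC (cmulr k l u) = (k +i* l) *: toC u.
Proof.
rewrite cmulrE toCD !toCZ -imul_toC /imul scalerA -scalerDl; congr (_ *: _).
by apply/eqP; rewrite eq_complex /=; apply/andP; split; apply/eqP; ring.
Qed.

Lemma cbilin_toC (u v : 'rV[R]_(d + d)) :
  cbilin 2 (toC u) (toC v) = rscal 2 u v +i* (- rscal 2 u (J v)).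
Proof.
have Re_sum (I : Type) (r : seq I) (F : I -> R[i]) :
    complex.Re (\sum_(i <- r) F i) = \sum_(i <- r) complex.Re (F i).
  exact: raddf_sum.
have Im_sum (I : Type) (r : seq I) (F : I -> R[i]) :
    complex.Im (\sum_(i <- r) F i) = \sum_(i <- r) complex.Im (F i).
  exact: raddf_sum.
apply/eqP; rewrite eq_complex /cbilin Re_sum Im_sum /=.
rewrite /rscal /imulr row_mxKl row_mxKr /pscal -!sumrB -sumrN.
apply/andP; split; apply/eqP; apply: eq_bigr => j _; rewrite /toC /cplx !mxE /=; ring.
Qed.

Lemma horizontal_toC (z w : 'rV[R]_(d + d)) :
  horizontal (toC z) (toC w) = toC (w + B w z *: z + B w (J z) *: J z).
Proof. by rewrite /horizontal imul_toC !cscal_toC !toCD !toCZ. Qed.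

Lemma line_scale (k : R[i]) (z : 'rV[R[i]]_d) : k != 0 -> line (k *: z) = line z.
Proof.
move=> k0; apply/seteqP; split => w [c ->]; first by exists (c * k); rewrite scalerA.
by exists (c * k^-1); rewrite scalerA mulfVK.
Qed.

Lemma mem_line (z : 'rV[R[i]]_d) : line z z.
Proof. by exists 1; rewrite scale1r. Qed.

Lemma complex_near1 (x y : R) : `|x| < 1 -> (1 + x) +i* y != 0.
Proof.
move=> x1; rewrite eq_complex negb_and /=; apply/orP; left.
by move: x1; rewrite ltr_norml => /andP[h _]; rewrite gt_eqF// -ltrBlDl sub0r.
Qed.

Variable k : qchart R n.
Hypothesis ck : quadric_chart k.
Let V := qcod k.
Let Q := ofC \o qlift k.

Lemma toC_qlift y : toC (Q y) = qlift k y.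
Proof. exact: ofCK. Qed.

Lemma horizontal_lift_hopf y w : horizontal_lift k y w = toC (hopf_lift 2 Q y w).
Proof. by rewrite /horizontal_lift -toC_qlift horizontal_toC. Qed.

Lemma qmetric_mx_hopf : qmetric_mx k = hopf_metric 2 Q.
Proof.
apply/funext => y; apply/matrixP => i j; rewrite !mxE /qmetric.
by rewrite !horizontal_lift_hopf cscal_toC.
Qed.

Lemma qmetric_J_hopf y u v : qmetric_J k y u v =
  B (J (hopf_lift 2 Q y u)) (hopf_lift 2 Q y v).
Proof. by rewrite /qmetric_J !horizontal_lift_hopf imul_toC cscal_toC. Qed.

Lemma open_qcod : open V. Proof. by case: ck. Qed.

Lemma qlift_twice_differentiable y : V y -> twice_differentiable Q y.
Proof. by case: ck => oV sQ _ _ _ Vy; exact: smooth_twice_differentiable oV sQ Vy. Qed.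

Lemma qlift_norm y : V y -> B (Q y) (Q y) = -1.
Proof.
by case: ck => _ _ hQ _ _ /hQ[+ _]; rewrite -cscal_toC toC_qlift.
Qed.

Lemma qlift_null y : V y -> rscal 2 (Q y) (Q y) = 0 /\ rscal 2 (Q y) (J (Q y)) = 0.
Proof.
case: ck => _ _ hQ _ _ /hQ[_ [_ [z Lz z0]]].
have [c cz] : line z (qlift k y) by rewrite -Lz; exact: mem_line.
have : cbilin 2 (qlift k y) (qlift k y) = 0.
  have -> : cbilin 2 (qlift k y) (qlift k y) = c ^+ 2 * cbilin 2 z z.
    rewrite cz /cbilin mulr_sumr; apply: eq_bigr => j _.
    by rewrite !mxE; ring.
  by rewrite z0 mulr0.
rewrite -toC_qlift cbilin_toC => /eqP; rewrite eq_complex /= oppr_eq0.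
by move=> /andP[/eqP -> /eqP ->].
Qed.

(** Moving by r q + s J q multiplies q by a complex number close to 1, which
    does not change its line. *)
Lemma derive_along_line (P : set 'rV[R[i]]_d -> 'rV[R]_(n + n))
    (q : 'rV[R]_(d + d)) (r s : R) : differentiable (P \o line \o toC) q ->
  'd (P \o line \o toC) q (r *: q + s *: J q) = 0.
Proof.
set F := P \o line \o toC => dF; set u := r *: q + s *: J q.
have e : differentiable F ((0 : R) *: u + q) by rewrite scale0r add0r.
have [_ E] := is_derive_along e.
rewrite [in RHS]scale0r [in RHS]add0r in E.
apply: etrans (esym (deriveE u dF)) _; apply: etrans (esym E) _.
have c0 : {near (0 : R), (fun t : R => F (t *: u + q)) =1 cst (F q)}.
  have pos : \forall t \near (0 : R), `|t * r| < 1.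
    have : t * r @[t --> (0 : R)] --> 0 * r by apply: cvgMl; exact: cvg_id.
    rewrite mul0r => /cvgrPdist_lt/(_ _ ltr01); apply: filterS => t.
    by rewrite sub0r normrN.
  apply: filterS pos => t tr; rewrite /F /=; congr (P _).
  have -> : toC (t *: u + q) = ((1 + t * r) +i* (t * s)) *: toC q.
    rewrite -toC_cmulr cmulrE /u; congr toC.
    by apply/rowP => j; rewrite !mxE; ring.
  by apply: line_scale; exact (complex_near1 _ tr).
have h := near_eq_derive (1 : R^o) c0.
apply: (etrans h).
exact: derive_cst.
Qed.

(** The coordinate map of the chart, extended to the cone, inverts Q to first
    order and kills the vertical vectors. *)
Lemma hopf_lift_qlift_inj y w : V y -> hopf_lift 2 Q y w = 0 -> w = 0.
Proof.
move=> Vy; case: (ck) => oV sQ hQ cQ [U [oU sP UP]].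
pose P := qcoord k \o line \o toC.
have dQ := twice_differentiable1 (qlift_twice_differentiable Vy).
have UQ : U (Q y).
  apply/UP; rewrite toC_qlift; first exact: (hQ _ Vy).2.
  by exists y.
have dP : differentiable P (Q y).
  exact: (twice_differentiable1 (smooth_twice_differentiable oU sP UQ)).
have id_PQ : 'D_w (fun y => P (Q y)) y = w.
  rewrite (@derive_eq_on_open _ _ _ V (fun y => P (Q y)) id oV) ?derive_id//.
  by move=> y' Vy'; rewrite /P /= toC_qlift cQ.
rewrite derive_comp// deriveE// in id_PQ.
rewrite /hopf_lift -addrA => /(congr1 ('d P (Q y))).
by rewrite linearD id_PQ (derive_along_line _ _ dP) addr0 linear0.
Qed.

End QuadricChart.

(** * The Gauss map of a spacelike immersion *)

Section ComplexExponential.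
Context {R : realType}.

Lemma cexpD (z w : R[i]) : cexp (z + w) = cexp z * cexp w.
Proof.
case: z w => [x y] [x' y']; rewrite /cexp /= expRD cosD sinD.
by apply/eqP; rewrite eq_complex /=; apply/andP; split; apply/eqP; ring.
Qed.

Lemma cexp0 : cexp (0 : R[i]) = 1.
Proof.
rewrite /cexp /= expR0 cos0 sin0.
by apply/eqP; rewrite eq_complex /=; apply/andP; split; apply/eqP; ring.
Qed.

Lemma cexp_sum k (x y : 'I_k -> R) :
  cexp ((\sum_j x j) +i* (\sum_j y j)) = \prod_j cexp (x j +i* y j).
Proof.
rewrite -(big_morph _ cexpD cexp0); congr cexp.
apply/eqP; rewrite eq_complex /= !raddf_sum /=.
by apply/andP; split; apply/eqP; apply: eq_bigr.
Qed.

(** The principal logarithm of 1 + i t. *)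
Lemma cexp_log (t : R) : cexp ((2^-1 * ln (1 + t ^+ 2)) +i* atan t) = 1 +i* t.
Proof.
have t0 : 0 < 1 + t ^+ 2 by rewrite ltr_pwDl// sqr_ge0.
have E : expR (2^-1 * ln (1 + t ^+ 2)) = Num.sqrt (1 + t ^+ 2).
  transitivity (Num.sqrt (expR (2^-1 * ln (1 + t ^+ 2)) ^+ 2)).
    by rewrite sqrtr_sqr ger0_norm// expR_ge0.
  congr Num.sqrt; rewrite -expRM_natl -[RHS](lnK t0); congr expR.
  by rewrite mulrA mulfV ?mul1r.
have s0 : Num.sqrt (1 + t ^+ 2) != 0 by rewrite sqrtr_eq0 -ltNge.
have sinE : sin (atan t) = t * (Num.sqrt (1 + t ^+ 2))^-1.
  rewrite -cos_atan -[X in X * _](atanK t) /tan mulfVK// cos_atan.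
  by rewrite invr_eq0.
rewrite /cexp /= E cos_atan sinE.
apply/eqP; rewrite eq_complex /=; apply/andP; split; apply/eqP; field => //.
Qed.

End ComplexExponential.

Section GaussImage.
Context {R : realType} {n : nat}.

(** On the line of x + i y the Hermitian form is -2 times the squared modulus
    of the coordinate. *)
Lemma quadric_gauss (x y : 'rV[R]_n.+2) :
  pscal 2 x x = -1 -> pscal 2 y y = -1 -> pscal 2 y x = 0 ->
  quadric (line (cplx x y)).
Proof.
move=> xx yy yx; set q := row_mx x y.
have Eq : cplx x y = toC q by rewrite /toC row_mxKl row_mxKr.
have qq : cscal 2 q q = -2 by rewrite cscal_row_mx xx yy; ring.
have q0 : cbilin 2 (toC q) (toC q) = 0.
  rewrite cbilin_toC imulr_row_mx !rscal_row_mx pscalNr (pscal_sym _ x y) xx yy yx.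
  by apply/eqP; rewrite eq_complex /=; apply/andP; split; apply/eqP; ring.
rewrite Eq; split; last by exists (toC q).
exists (toC q); split=> //.
  apply/eqP => z0; move: qq; rewrite -cscal_toC z0.
  rewrite /pscalC big1 /=; last by move=> j _; rewrite mxE mulr0 mul0r.
  lra.
move=> _ [[k l] ->] kl0; rewrite -toC_cmulr cscal_toC cscal_cmulr qq.
have kl : 0 < k ^+ 2 + l ^+ 2.
  rewrite lt_neqAle addr_ge0 ?sqr_ge0// andbT eq_sym paddr_eq0 ?sqr_ge0//.
  rewrite !expf_eq0 /=; apply/negP => /andP[/eqP k0 /eqP l0].
  by move/negP: kl0; apply; rewrite k0 l0 (_ : 0 +i* 0 = 0) ?scale0r.
by rewrite pmulr_rlt0// oppr_lt0.
Qed.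

End GaussImage.

Lemma linear_factor {R : pzRingType} {n : nat} {U : lmodType R}
    (f g : {linear 'rV[R]_n -> U}) :
  (forall i, exists w, g (delta_mx 0 i) = f w) ->
  exists S : 'M[R]_n, forall v, g v = - f (v *m S).
Proof.
move=> /choice[w wE]; exists (\matrix_(i, j) - w i 0 j) => u.
rewrite {1}(row_sum_delta u) linear_sum mulmx_sum_row linear_sum -sumrN.
apply: eq_bigr => i _; rewrite !linearZ /=; congr (_ *: _).
have -> : row i (\matrix_(i, j) - w i 0 j) = - w i.
  by apply/rowP => j; rewrite !mxE.
by rewrite linearN opprK wE.
Qed.

Section ChartOfM.
Local Opaque derive diff.
Context {R : realType} {n : nat} {M : manifold R n}.
Variables (a b : M -> 'rV[R]_n.+2) (lam : M -> 'I_n -> R).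
Hypothesis ha : spacelike_immersion a.
Hypothesis hb : unit_normal a b.
Hypothesis hlam : shape_eigenvalues a b lam.
Variable c : chart R n M.
Hypothesis ac : atlas c.
Local Notation W := (cod c).
Local Notation a' := (a \o param c).
Local Notation b' := (b \o param c).

Lemma cod_param y : W y -> dom c (param c y) /\ Defs.coord c (param c y) = y.
Proof.
move=> [q dq <-]; have [_ _ pc _ _] := atlas_chart ac.
by rewrite pc.
Qed.

Lemma open_cod : open W.
Proof. by have [_ + _ _ _] := atlas_chart ac. Qed.

Lemma coord_cod p : dom c p -> W (Defs.coord c p).
Proof. by move=> dp; exists p. Qed.

Lemma immersion_twice_differentiable y : W y -> twice_differentiable a' y.
Proof.
by move=> Wy; have [sa _ _ _] := ha; exact: smooth_twice_differentiable open_cod (sa c ac) Wy.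
Qed.

Lemma normal_twice_differentiable y : W y -> twice_differentiable b' y.
Proof.
by move=> Wy; have [sb _ _ _] := hb; exact: smooth_twice_differentiable open_cod (sb c ac) Wy.
Qed.

Lemma immersion_norm y : W y -> pscal 2 (a' y) (a' y) = -1.
Proof. by move=> _; have [_ aa _ _] := ha; exact: aa. Qed.

Lemma normal_norm y : W y -> pscal 2 (b' y) (b' y) = -1.
Proof. by move=> _; have [_ bb _ _] := hb; exact: bb. Qed.

Lemma normal_position y : W y -> pscal 2 (b' y) (a' y) = 0.
Proof. by move=> _; have [_ _ ba _] := hb; exact: ba. Qed.

Lemma normal_tangent y v : W y -> pscal 2 (b' y) ('D_v a' y) = 0.
Proof.
move=> Wy; have [dq cq] := cod_param Wy; have [_ _ _ bda] := hb.
have := bda c _ v ac dq; rewrite /differential cq deriveE//.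
exact: (twice_differentiable1 (immersion_twice_differentiable Wy)).
Qed.

Lemma immersion_spacelike y v : W y -> v != 0 ->
  0 < pscal 2 ('D_v a' y) ('D_v a' y).
Proof.
move=> Wy v0; have [dq cq] := cod_param Wy; have [_ _ _ pos] := ha.
have := pos c _ v ac dq v0; rewrite /differential cq deriveE//.
exact: (twice_differentiable1 (immersion_twice_differentiable Wy)).
Qed.

Lemma shape_operatorP y v : W y ->
  'D_v b' y = - 'D_(v *m shape_operator a b c (param c y)) a' y.
Proof.
move=> Wy; have [dq cq] := cod_param Wy.
have da := twice_differentiable1 (immersion_twice_differentiable Wy).
have db := twice_differentiable1 (normal_twice_differentiable Wy).
have exS : exists S : 'M[R]_n, forall v, 'd b' y v = - 'd a' y (v *m S).
  apply: linear_factor => i.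
  have [w wE] := @weingarten R n W a' b' open_cod immersion_twice_differentiable
    normal_twice_differentiable immersion_norm normal_norm normal_position
    (fun y v => @normal_tangent y v) y Wy (fun v => @immersion_spacelike y v Wy)
    (delta_mx 0 i).
  exists w; exact (etrans (esym (deriveE _ db)) (etrans wE (deriveE _ da))).
rewrite (deriveE _ da) (deriveE _ db) /shape_operator /differential cq.
move: v; exact: (xgetPex 0 exS).
Qed.

Lemma gauss_pencil y : W y ->
  [/\ \det (first_form a' y) != 0,
      \det ('X *: map_mx polyC (first_form a' y) - map_mx polyC (second_form a' b' y))
      = \prod_(j < n) ('X - (lam (param c y) j)%:P) * (\det (first_form a' y))%:P &
      \det (cplx_mx (first_form a' y) (second_form a' b' y)) =
      (\det (first_form a' y))%:C * \prod_(j < n) ((1 : R) +i* lam (param c y) j)].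
Proof.
move=> Wy; have [dq cq] := cod_param Wy.
pose S := shape_operator a b c (param c y).
have hE : second_form a' b' y = S *m first_form a' y.
  apply: (@second_formE _ _ W) => //; first exact: immersion_twice_differentiable.
  by move=> v; exact: shape_operatorP.
have chi : char_poly S = \prod_(j < n) ('X - (lam (param c y) j)%:P) by exact: hlam.
split.
- apply: (@first_form_det _ _ W) => //; first exact: immersion_twice_differentiable.
  by move=> v; exact: immersion_spacelike.
- have -> : 'X *: map_mx polyC (first_form a' y) - map_mx polyC (second_form a' b' y)
      = char_poly_mx S *m map_mx polyC (first_form a' y).
    by rewrite hE /char_poly_mx mulmxBl mul_scalar_mx map_mxM.
  by rewrite det_mulmx det_map_mx -chi.
- have -> : cplx_mx (first_form a' y) (second_form a' b' y) =
      cplx_mx 1%:M S *m map_mx (real_complex R) (first_form a' y).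
    rewrite hE [cplx_mx 1%:M S]cplx_mxE [LHS]cplx_mxE mulmxDl -scalemxAl.
    by rewrite map_mx1 mul1mx map_mxM.
  by rewrite det_mulmx det_map_mx (det_one_plus_i_shape chi) mulrC.
Qed.

Lemma differentiable_cvg (F : 'rV[R]_n -> R) y :
  differentiable F y -> F t @[t --> y] --> F y.
Proof. by move=> dF; exact: differentiable_continuous dF. Qed.

(** The characteristic polynomial of S depends continuously on the point
    because S A and A do. *)
Lemma eigenvalue_sum_continuous (phi : R -> R) y : continuous phi -> W y ->
  {for y, continuous (fun y => \sum_(j < n) phi (lam (param c y) j))}.
Proof.
move=> cphi Wy; pose l t := [seq lam (param c t) j | j <- enum 'I_n].
have sl t : size (l t) = n by rewrite size_map size_enum_ord.
have lE (psi : R -> R) t : \sum_(j < n) psi (lam (param c t) j) = \sum_(r <- l t) psi r.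
  by rewrite big_map big_enum.
have plE t : \prod_(j < n) ('X - (lam (param c t) j)%:P) = \prod_(r <- l t) ('X - r%:P).
  by rewrite big_map big_enum.
have E : (fun y => \sum_(j < n) phi (lam (param c y) j)) =
    (fun y => \sum_(r <- l y) phi r) by apply/funext => t; rewrite lE.
rewrite /prop_for /continuous_at E lE.
suff H : coef_continuous y (fun t => \prod_(r <- l t) ('X - r%:P)).
  exact (@cvg_symmetric_sum R _ (nbhs y) _ n l (l y) phi cphi sl (sl y) H).
apply: (@coef_continuous_pencil _ _ y n (first_form a') (second_form a' b')).
- have nW : {near y, forall t, W t} := open_nbhs_nbhs (conj open_cod Wy).
  by apply: filterS nW => t Wt; have [A0 + _] := gauss_pencil Wt; rewrite plE.
- move=> i j; apply: differentiable_cvg.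
  have := @derive_first_form _ _ W a' immersion_twice_differentiable _ Wy 0 i j.
  by case.
- move=> i j; apply: differentiable_cvg.
  exact: (@differentiable_second_form _ _ W a' b' immersion_twice_differentiable
    normal_twice_differentiable _ Wy).
Qed.

Section Branch.
Let F (q : M) : R[i] := \prod_(j < n) ((1 : R) +i* lam q j).
Variable k : qchart R n.
Hypothesis ck : quadric_chart k.
Variable p : M.
Hypothesis dp : dom c p.
Hypothesis kp : qdom k (gauss_map a b p).
Local Notation x := (Defs.coord c p).
Local Notation f := (gauss_map_coord a b c k).
Local Notation Q := (ofC \o qlift k).
Local Notation zeta := (fun y => row_mx (a' y) (b' y)).

Lemma param_continuous : {for x, continuous (param c)}.
Proof. by have [_ _ _ _] := atlas_chart ac; apply; exact: coord_cod. Qed.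

Lemma param_coord : param c x = p.
Proof. by have [_ _ pc _ _] := atlas_chart ac; exact: pc. Qed.

Lemma toC_zeta y : toC (zeta y) = cplx (a' y) (b' y).
Proof. by rewrite /toC row_mxKl row_mxKr. Qed.

Lemma zeta_twice_differentiable y : W y -> twice_differentiable zeta y.
Proof.
move=> Wy; apply: twice_differentiable_row_mx.
  exact: immersion_twice_differentiable.
exact: normal_twice_differentiable.
Qed.

(** The conditions that define it only use the extension of the coordinates of
    the chart to the cone, so they are open in x. *)
Lemma gauss_domain : exists N : set 'rV[R]_n, [/\ open N, N x, N `<=` W,
  forall y, N y -> twice_differentiable f y &
  forall y, N y -> qcod k (f y) /\
    exists r s, zeta y = cmulr r s (Q (f y))].
Proof.
have [oV sQ hQ cQ [U [oU sP UP]]] := ck.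
have fE : f = (fun y => (qcoord k \o line \o toC) (zeta y)).
  by apply/funext => y; rewrite /= toC_zeta.
have quadW y : W y -> quadric (line (toC (zeta y))).
  move=> Wy; rewrite toC_zeta; apply: quadric_gauss.
  - exact: immersion_norm.
  - exact: normal_norm.
  - exact: normal_position.
exists [set y | W y /\ U (zeta y)]; split.
- rewrite openE => y [Wy Uy]; apply: filterI.
    exact: (open_nbhs_nbhs (conj open_cod Wy)).
  have cz := differentiable_continuous (twice_differentiable1 (zeta_twice_differentiable Wy)).
  exact: (cz _ (open_nbhs_nbhs (conj oU Uy))).
- split; first exact: coord_cod.
  apply/UP; first exact/quadW/coord_cod.
  by rewrite toC_zeta /= param_coord.
- by move=> y [].
- move=> y [Wy Uy]; rewrite fE.
  apply: (twice_differentiable_comp (zeta_twice_differentiable Wy) _).1.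
  exact: smooth_twice_differentiable oU sP Uy.
- move=> y [Wy /UP] /(_ (quadW _ Wy)) [y' Vy' Ey'].
  have fy : f y = y' by rewrite fE /= -Ey' cQ.
  split; first by rewrite fy.
  have : line (qlift k y') (toC (zeta y)) by rewrite Ey'; exact: mem_line.
  move=> [[r s] rs]; exists r, s.
  by rewrite -[LHS]toCK rs -[qlift k y']ofCK -toC_cmulr toCK fy.
Qed.

Lemma gauss_branch (U : set M) (L : M -> R[i]) : U p -> log_branch U F L ->
  differentiable_at (fun q => complex.Im (L q)) c p /\
  forall v, gJH a b c k p v =
    n%:R^-1 * differential (fun q => complex.Im (L q)) c p v.
Proof.
move=> Up [oU expL _ cIm].
have [N [oN Nx NW Cf fV]] := gauss_domain.
pose theta y := complex.Im (L (param c y)).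
pose rho y := expR (complex.Re (L (param c y))).
have ctheta : {for x, continuous theta}.
  apply: (@continuous_comp _ _ _ (param c) (fun q => complex.Im (L q))); first exact: param_continuous.
  by rewrite param_coord; exact: cIm.
have near_rho : {near x, forall y, rho y != 0 /\
    F (param c y) = (rho y * cos (theta y)) +i* (rho y * sin (theta y))}.
  have nU : {near x, forall y, U (param c y)}.
    have nU : nbhs (param c x) U.
      by rewrite param_coord; exact: (open_nbhs_nbhs (conj oU Up)).
    exact: (param_continuous nU).
  apply: filterS nU => y Uy; split; first by rewrite gt_eqF// expR_gt0.
  rewrite -expL// /cexp.
  apply/eqP; rewrite eq_complex /= !mul0r subr0 addr0.
  by rewrite /rho /theta !eqxx.
have [dtheta E] : differentiable theta x /\ forall v,
    cscal 2 (imulr (hopf_lift 2 Q (f x) (mean_curvature (hopf_metric 2 Q) f x)))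
      (hopf_lift 2 Q (f x) ('D_v f x)) = n%:R^-1 * 'D_v theta x.
  apply: (@gauss_angle R n (n + n) N (qcod k) a' b' f Q oN (open_qcod ck)
    (fun y Ny => immersion_twice_differentiable (NW _ Ny))
    (fun y Ny => normal_twice_differentiable (NW _ Ny))
    Cf (@qlift_twice_differentiable _ _ _ ck) (fun y Ny => (fV y Ny).1)
    (@qlift_norm _ _ _ ck)
    (fun y Ny => immersion_norm (NW _ Ny)) (fun y Ny => normal_norm (NW _ Ny))
    (fun y Ny => normal_position (NW _ Ny))
    (fun y v Ny => normal_tangent v (NW _ Ny))
    (fun y Ny => (fV y Ny).2) (@qlift_null _ _ _ ck) (leqnn _) x Nx
    (fun v => @immersion_spacelike x v (NW _ Nx))
    (fun w => @hopf_lift_qlift_inj _ _ _ ck _ w (fV _ Nx).1)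
    (shape_operator a b c (param c x))
    (fun v => shape_operatorP v (NW _ Nx)) theta rho (fun y => F (param c y))) => //.
  by move=> y /NW /gauss_pencil[].
split=> // v; rewrite /gJH /gauss_mean_curvature qmetric_mx_hopf qmetric_J_hopf.
rewrite /differential -(deriveE v dtheta) -E deriveE//.
exact: (twice_differentiable1 (Cf _ Nx)).
Qed.

(** Built from the principal logarithms of the factors 1 + i lambda_j; its
    imaginary part is the sum of the arctangents. *)
Lemma gauss_branch_exists :
  log_branch (dom c) F (fun q =>
    (\sum_(j < n) 2^-1 * ln (1 + lam q j ^+ 2)) +i* (\sum_(j < n) atan (lam q j))).
Proof.
have [od _ pc cc _] := atlas_chart ac.
have ct (phi : R -> R) q : continuous phi -> dom c q ->
    {for q, continuous (fun q => \sum_(j < n) phi (lam q j))}.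
  move=> cphi dq.
  have cs := eigenvalue_sum_continuous cphi (coord_cod dq).
  have E : {near q, (fun q => \sum_(j < n) phi (lam (param c (Defs.coord c q)) j)) =1
      (fun q => \sum_(j < n) phi (lam q j))}.
    have nd : {near q, forall q, dom c q} := open_nbhs_nbhs (conj od dq).
    by apply: filterS nd => q' dq'; rewrite pc.
  rewrite /prop_for /continuous_at -(nbhs_singleton E).
  apply: cvg_trans (near_eq_cvg E) _.
  exact: (cvg_comp _ _ (cc _ dq) cs).
split=> // q dq.
- rewrite cexp_sum; apply: eq_bigr => j _; exact: cexp_log.
- apply: (ct (fun t => 2^-1 * ln (1 + t ^+ 2))) => // t.
  have t0 : 0 < 1 + t ^+ 2 by rewrite ltr_pwDl// sqr_ge0.
  apply: cvgMr; apply: (@continuous_comp _ _ _ (fun t : R => 1 + t ^+ 2) (@ln R)).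
    by apply: cvgD; [exact: cvg_cst|exact: exprn_continuous].
  exact: continuous_ln.
- apply: (ct (@atan R)) => // t; exact: continuous_atan.
Qed.

End Branch.

End ChartOfM.

Theorem theorem4p5 (R : realType) (n : nat) (M : manifold R n)
    (a b : M -> 'rV[R]_n.+2) (lam : M -> 'I_n -> R) :
  (0 < n)%N ->
  spacelike_immersion a ->
  unit_normal a b ->
  shape_eigenvalues a b lam ->
  let angle_sum := fun q : M => \sum_(j < n) atan (lam q j) in
  let F := fun q : M => \prod_(j < n) ((1 : R) +i* lam q j) in
  forall (c : chart R n M) (k : qchart R n) (p : M),
    atlas c -> dom c p ->
    quadric_chart k -> qdom k (gauss_map a b p) ->
    [/\ differentiable_at angle_sum c p,
        forall v, gJH a b c k p v = n%:R^-1 * differential angle_sum c p v,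
        exists (U : set M) (L : M -> R[i]), U p /\ log_branch U F L &
        forall (U : set M) (L : M -> R[i]), U p -> log_branch U F L ->
          let ImL := fun q : M => complex.Im (L q) in
          differentiable_at ImL c p /\
          forall v, gJH a b c k p v = n%:R^-1 * differential ImL c p v].
Proof.
move=> _ ha hb hlam angle_sum F c k p ac dp ck kp.
have branch := gauss_branch_exists ha hb hlam ac.
have [d E] := gauss_branch ha hb hlam ac ck dp kp dp branch.
split; [exact d|exact E| |].
  by exists (dom c); eexists; split; [exact: dp|exact: branch].
by move=> U L Up UL; exact (gauss_branch ha hb hlam ac ck dp kp Up UL).
Qed.
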